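(* Let $T$ be a locally compact Hausdorff space with a bounded Radon measure $\mu$, and let $\mathscr{A}$ and $\mathscr{B}$ be unital $C^*$-algebras. If $1<r\le 2$, $a:T\to\mathbb{R}$ is a bounded continuous nonnegative function and $(\phi_t)_{t\in T}$ is a field of positive linear mappings $\phi_t:\mathscr{A}\to\mathscr{B}$ satisfying $$\int_T a(t)^{\frac1{1-r}}\phi_t(I)\,d\mu(t)\le\int_T a(t)^{\frac1{1-r}}\,d\mu(t)\; I,$$ then $$\left(\int_T\phi_t(A_t)\,d\mu(t)\right)^{r}\le\left(\int_T a(t)^{\frac1{1-r}}\,d\mu(t)\right)^{r-1}\int_T a(t)\,\phi_t(A_t^r)\,d\mu(t)$$ holds for all continuous fields $(A_t)_{t\in T}$ of positive elements in $\mathscr{A}$.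
   Context: The $C^*$-algebras are $C^*$-algebras of Hilbert space operators, and $I$ denotes the identity of either algebra. A field indexed by $T$ is a family indexed by the points of $T$. A field $(A_t)_{t\in T}$ of operators in a $C^*$-algebra is called continuous if the function $t\mapsto A_t$ is norm continuous on $T$. For a continuous field $(A_t)_{t\in T}$ such that $t\mapsto\|A_t\|$ is $\mu$-integrable, $\int_T A_t\,d\mu(t)$ denotes the Bochner integral, i.e. the unique element of the algebra such that $\varphi\left(\int_T A_t\,d\mu(t)\right)=\int_T\varphi(A_t)\,d\mu(t)$ for every linear functional $\varphi$ in the norm dual of the algebra. The order is the usual operator order on self-adjoint elements. *)

(* Defs.v *)
From HB Require Import structures.
From mathcomp Require Import all_boot all_order all_algebra.
From mathcomp Require Import complex.
From mathcomp Require Import all_classical all_reals all_analysis.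

Set Implicit Arguments.
Unset Strict Implicit.
Unset Printing Implicit Defensive.
Import Order.TTheory GRing.Theory Num.Theory.
Import numFieldNormedType.Exports.
Local Open Scope classical_set_scope.
Local Open Scope ring_scope.

(* Complex Hilbert spaces. [dot] is linear in its first argument; the norm of a
   normed module over [R[i]] takes its values in [R[i]]. *)
HB.mixin Record CompleteNormedModule_isHilbert (R : realType) H
    of CompleteNormedModule R[i] H := {
  dot : {dot H for Num.conj} ;
  sqr_norm_dot : forall x : H, `|x| ^+ 2 = dot x x }.

#[short(type="hilbertType")]
HB.structure Definition Hilbert (R : realType) :=
  { H of CompleteNormedModule_isHilbert R H & CompleteNormedModule R[i] H }.

Section Operators.
Context {R : realType} {H : hilbertType R}.
Implicit Types (X Y : H -> H) (z : R[i]).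

Definition bounded_operator X : Prop := linear X /\ continuous X.

(* Meaningful on bounded operators only ([sup] of an unbounded set is 0). *)
Definition opnorm X : R :=
  sup [set complex.Re `|X x| | x in [set x : H | `|x| <= 1]].

Definition adjoint X Y : Prop :=
  forall x y : H, dot (X x) y = dot x (Y y).

(* [0 <= z] in [R[i]] says that [z] is a nonnegative real, so that a positive
   bounded operator is self-adjoint. *)
Definition op_pos X : Prop := forall x : H, 0 <= dot (X x) x.

Definition op_le X Y : Prop := op_pos (Y - X).

End Operators.

(* Unital C*-algebras of operators on [H]. The identity element is not required
   to be the identity operator of [H]. *)
Record cstarAlgebra (R : realType) (H : hilbertType R) := CStarAlgebra {
  cstar_set :> (H -> H) -> Prop ;
  cstar_one : H -> H ;
  cstar_bounded : forall X, cstar_set X -> bounded_operator X ;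
  cstar_linear : forall (c : R[i]) X Y,
    cstar_set X -> cstar_set Y -> cstar_set (c *: X + Y) ;
  cstar_mul : forall X Y, cstar_set X -> cstar_set Y -> cstar_set (X \o Y) ;
  cstar_adjoint : forall X, cstar_set X -> exists2 Y, cstar_set Y & adjoint X Y ;
  cstar_closed : forall X, bounded_operator X ->
    (forall e : R, 0 < e -> exists2 Y, cstar_set Y & opnorm (X - Y) < e) ->
    cstar_set X ;
  cstar_one_in : cstar_set cstar_one ;
  cstar_mul1l : forall X, cstar_set X -> cstar_one \o X = X ;
  cstar_mul1r : forall X, cstar_set X -> X \o cstar_one = X }.

Section FunctionalCalculus.
Context {R : realType} {H : hilbertType R} (A : cstarAlgebra H).
Implicit Types (X Y : H -> H) (p : {poly R}).

Definition spectrum X : set R[i] :=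
  [set z | ~ exists2 Y, A Y & (z *: cstar_one A - X) \o Y = cstar_one A /\
                              Y \o (z *: cstar_one A - X) = cstar_one A].

Definition op_expn X (n : nat) : H -> H :=
  iter n (fun Y => X \o Y) (cstar_one A).

Definition op_poly X p : H -> H :=
  \sum_(i < size p) (p`_i)%:C%C *: op_expn X i.

(* Continuous functional calculus of a self-adjoint [X], whose spectrum is real:
   [f(X)] is the norm limit of [p_n(X)] for real polynomials [p_n] converging
   to [f] uniformly on the spectrum of [X]. *)
Definition is_cfc (f : R -> R) X Y : Prop :=
  A Y /\ exists p : nat -> {poly R},
    (forall e : R, 0 < e -> \forall n \near \oo,
       forall x : R, spectrum X x%:C%C -> `|(p n).[x] - f x| < e) /\
    opnorm (op_poly X (p n) - Y) @[n --> \oo] --> (0 : R).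

Definition cfc (f : R -> R) X : H -> H := xget 0 [set Y | is_cfc f X Y].

Definition op_powR X (r : R) : H -> H := cfc (fun x => x `^ r) X.

End FunctionalCalculus.

Definition positive_map {R : realType} {H K : hilbertType R}
    (A : cstarAlgebra H) (B : cstarAlgebra K) (phi : (H -> H) -> (K -> K)) :
    Prop :=
  [/\ forall X, A X -> B (phi X),
      forall (c : R[i]) X Y, A X -> A Y ->
        phi (c *: X + Y) = c *: phi X + phi Y
    & forall X, A X -> op_pos X -> op_pos (phi X)].

Definition norm_dual {R : realType} {H : hilbertType R} (A : cstarAlgebra H)
    (l : (H -> H) -> R[i]) : Prop :=
  (forall (c : R[i]) X Y, A X -> A Y -> l (c *: X + Y) = c * l X + l Y) /\
  exists M : R, forall X, A X -> complex.Re `|l X| <= M * opnorm X.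

Notation borelType T := (g_sigma_algebraType (@open T)).

(* Inner regularity by compact sets, for finite Borel measures on a Hausdorff
   space. *)
Definition radon {R : realType} {T : ptopologicalType}
    (mu : {finite_measure set (borelType T) -> \bar R}) : Prop :=
  forall E : set (borelType T), measurable E ->
    mu E = ereal_sup [set mu C | C in [set C : set T | compact C /\ C `<=` E]].

Section Integrals.
Context {R : realType} {T : ptopologicalType}.
Variable mu : {finite_measure set (borelType T) -> \bar R}.

Definition complex_integrable (f : borelType T -> R[i]) : Prop :=
  mu.-integrable setT (fun t => (complex.Re (f t))%:E) /\
  mu.-integrable setT (fun t => (complex.Im (f t))%:E).

Definition complex_integral (f : borelType T -> R[i]) : R[i] :=
  Complex (\int[mu]_t complex.Re (f t))%R (\int[mu]_t complex.Im (f t))%R.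

Context {H : hilbertType R} (A : cstarAlgebra H).
Implicit Types F : borelType T -> (H -> H).

(* The integral is determined by its values under the norm dual of [A]; vector
   functionals already separate operators, hence uniqueness. *)
Definition is_bochner_integral F (V : H -> H) : Prop :=
  A V /\ forall l, norm_dual A l ->
    complex_integrable (l \o F) /\ l V = complex_integral (l \o F).

Definition bochner_integrable F : Prop :=
  [/\ forall t, A (F t),
      mu.-integrable setT (fun t => (opnorm (F t))%:E)
    & exists V, is_bochner_integral F V].

Definition bochner_integral F : H -> H :=
  xget 0 [set V | is_bochner_integral F V].

End Integrals.

Definition continuous_field {R : realType} {T : ptopologicalType}
    {H : hilbertType R} (X : T -> (H -> H)) : Prop :=
  forall t, opnorm (X s - X t) @[s --> t] --> (0 : R).

(* Real power of a nonnegative real with the convention [0^s = +oo] for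
   [s < 0], whereas [powR] has [0 `^ s = 0] there. *)
Definition epowR {R : realType} (x s : R) : \bar R :=
  if (x == 0) && (s < 0) then +oo%E else (x `^ s)%:E.

(* Main.v *)
Require Import Defs.
From HB Require Import structures.
From mathcomp Require Import all_boot all_order all_algebra.
From mathcomp Require Import complex.
From mathcomp Require Import all_classical all_reals all_analysis.
From mathcomp Require Import measurable_realfun.
From mathcomp Require Import ring lra zify.

Set Implicit Arguments.
Unset Strict Implicit.
Unset Printing Implicit Defensive.
Import Order.TTheory GRing.Theory Num.Theory.
Import numFieldNormedType.Exports.
Local Open Scope classical_set_scope.
Local Open Scope ring_scope.

(** Write [w = a ^ (1 / (1 - r))], so that [a = w ^ (1 - r)], let [c] be the
    integral of [w], [V] the integral of [phi_t(X_t)] and [M <= c] the integral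
    of [w phi_t(1)].

    The function [x ^ r], [1 < r <= 2], is a limit of finite sums of functions
    [x ^ 2 / (al x + be)] that stay below it ([powR_quadratic_fractions]). This
    is the discrete form of the integral representation that makes [x ^ r]
    operator convex. Every such fraction has the variational description

      <V g(V)^-1 V xi, xi> = max over eta of 2 Re <V xi, eta> - <g(V) eta, eta>

    with [g(x) = al x + be]. It is used in both directions.

    On the one hand ([powR_variational]), for a given [xi] there are vectors
    [eta_i] such that [c ^ (1 - r) <V ^ r xi, xi>] is, up to a small error, at
    most the sum over [i] of
    [2 Re <V xi, eta_i> - al_i <V eta_i, eta_i> - c be_i <eta_i, eta_i>].
    On the other hand ([positive_map_powR]), the same vectors give, for each [t]
    with [a(t) > 0], the upper bound [a <phi_t(X_t ^ r) xi, xi>] for the sum of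
    [2 Re <phi_t(X_t) xi, eta_i> - al_i <phi_t(X_t) eta_i, eta_i>
     - w be_i <phi_t(1) eta_i, eta_i>].
    The second sum is an affine expression in [phi_t(X_t)] and [w phi_t(1)], hence
    can be integrated over [t], and [M <= c] bounds the first sum by the integral
    of the second one. The set where [a] vanishes is negligible, because the
    integral of [w] is finite ([epowR_null]).

    The pointwise bound is the positivity of a quadratic form in several vectors.
    A positive map need not be completely positive, but it behaves so on the
    commutative algebra generated by [X_t]: the Bernstein basis gives positive
    elements [b_k(X_t)] with [sum b_k(X_t) = 1], [sum x_k b_k(X_t) = X_t] exactly
    and [sum x_k ^ r b_k(X_t)] close to [X_t ^ r], so that the bound holds because
    it holds for each node [x_k].

    Both directions rest on the fact that a real polynomial that is nonnegative
    on the spectrum is positive at the operator ([op_poly_pos]), and on the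
    existence of the powers ([op_powR_cfc]). *)

(** * Powers as sums of fractions [x ^ 2 / (al * x + be)] *)

(** The integral of [l ^ (p - 1) * x / (x + l)] over [l > 0] is proportional to
    [x ^ p]. Here it is discretized on the grid of the powers of [th], with
    [ta] standing for [th ^ p]; the scaling [x |-> th * x] shifts the grid, and
    this replaces the change of variables, so that no integral has to be
    evaluated. *)
Section GeometricGrid.
Context {R : realType}.
Variables (th ta : R).
Hypotheses (ta_gt1 : 1 < ta) (ta_th : ta < th).

Let th_gt1 : 1 < th. Proof. exact: lt_trans ta_th. Qed.
Let th_gt0 : 0 < th. Proof. exact: lt_trans th_gt1. Qed.
Let ta_gt0 : 0 < ta. Proof. exact: lt_trans ta_gt1. Qed.
Let thz_gt0 (k : int) : 0 < th ^ k. Proof. exact: exprz_gt0. Qed.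
Let taz_gt0 (k : int) : 0 < ta ^ k. Proof. exact: exprz_gt0. Qed.

Definition grid_term (k : int) : R := ta ^ k / (1 + th ^ k).
Definition grid_sum (m : int) (n : nat) : R :=
  \sum_(i < n) grid_term (i%:Z - m).
Definition grid_fun (m : int) (n : nat) (x : R) : R :=
  \sum_(i < n) ta ^ (i%:Z - m) * x / (x + th ^ (i%:Z - m)).

Lemma grid_term_gt0 k : 0 < grid_term k.
Proof. by rewrite divr_gt0// addr_gt0. Qed.

Lemma grid_fun_scale m n k :
  grid_fun m n (th ^ k) = ta ^ k * grid_sum (m + k) n.
Proof.
rewrite /grid_fun /grid_sum mulr_sumr; apply: eq_bigr => i _.
rewrite /grid_term opprD addrA.
set j := i%:Z - m.
have -> : ta ^ j = ta ^ k * ta ^ (j - k).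
  by rewrite -expfzDr ?gt_eqF// addrC subrK.
have -> : th ^ j = th ^ k * th ^ (j - k).
  by rewrite -expfzDr ?gt_eqF// addrC subrK.
have := thz_gt0 k; have := thz_gt0 (j - k).
move: (th ^ k) (th ^ (j - k)) => u v v0 u0.
field.
by rewrite !gt_eqF ?addr_gt0 ?mulr_gt0.
Qed.

Lemma grid_fun_homo m n x y : 0 < x -> x <= y ->
  grid_fun m n x <= grid_fun m n y.
Proof.
move=> x0 xy; have y0 := lt_le_trans x0 xy.
apply: ler_sum => i _; rewrite -!mulrA ler_pM2l//.
have := thz_gt0 (i%:Z - m); move: (th ^ _) => u u0.
rewrite ler_pdivrMr ?addr_gt0// mulrAC ler_pdivlMr ?addr_gt0//.
by rewrite !mulrDr (mulrC y x) lerD2l ler_pM2r.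
Qed.

(** The terms decay geometrically on both sides, like [ta ^ k] for [k < 0] and
    like [(ta / th) ^ k] for [k >= 0]. Truncated at [1], these two sequences
    have as increments the dominating terms on their own half line and zero on
    the other one, so that a combination [G] of both, which is bounded,
    telescopes. *)
Lemma grid_sum_bounded : exists C, forall m n, grid_sum m n <= C.
Proof.
pose q := ta / th.
have q_gt0 : 0 < q by rewrite divr_gt0.
have q_lt1 : q < 1 by rewrite ltr_pdivrMr// mul1r.
pose A := (ta - 1)^-1; pose B := (1 - q)^-1.
have A0 : 0 < A by rewrite invr_gt0 subr_gt0.
have B0 : 0 < B by rewrite invr_gt0 subr_gt0.
pose G (j : int) := A * Num.min 1 (ta ^ j) - B * Num.min 1 (q ^ j).
have qz (j : int) : 0 < q ^ j by exact: exprz_gt0.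
have min01 (z : R) : 0 < z -> 0 <= Num.min 1 z <= 1.
  by move=> z0; rewrite ge_min lexx le_min ler01 (ltW z0).
have GA j : G j <= A.
  have /andP[? ?] := min01 _ (taz_gt0 j); have /andP[? ?] := min01 _ (qz j).
  rewrite /G; nra.
have GB j : - B <= G j.
  have /andP[? ?] := min01 _ (taz_gt0 j); have /andP[? ?] := min01 _ (qz j).
  rewrite /G; nra.
have Gincr j : grid_term j <= G (j + 1) - G j.
  have [j0|j0] := leP 0 j.
    have h1 (i : int) : 0 <= i -> Num.min 1 (ta ^ i) = 1.
      by move=> i0; apply/min_idPl; rewrite -(expr0z ta) ler_weXz2l// ltW.
    have h2 (i : int) : 0 <= i -> Num.min 1 (q ^ i) = q ^ i.
      move=> i0; apply/min_idPr; rewrite -(expr0z q).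
      by rewrite ler_wpiXz2l ?(ltW q_gt0) ?(ltW q_lt1).
    rewrite /G !h1 ?addr_ge0// !h2 ?addr_ge0//.
    rewrite expfzDr ?gt_eqF// expr1z.
    have -> : A * 1 - B * (q ^ j * q) - (A * 1 - B * q ^ j) = q ^ j.
      by rewrite /B; field; rewrite subr_eq0 gt_eqF.
    rewrite /grid_term /q expfzMl exprz_inv -invr_expz ler_pM2l// lef_pV2 ?posrE ?addr_gt0//.
    by rewrite lerDr.
  have h1 (i : int) : i <= 0 -> Num.min 1 (q ^ i) = 1.
    move=> i0; apply/min_idPl; rewrite -(opprK i) -invr_expz invf_ge1//.
    rewrite -(expr0z q); apply: ler_wpiXz2l; rewrite ?inE ?oppr_ge0 ?(ltW q_gt0) ?(ltW q_lt1)//.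
    by have : 0 <= - i by rewrite oppr_ge0.
  have h2 (i : int) : i <= 0 -> Num.min 1 (ta ^ i) = ta ^ i.
    by move=> i0; apply/min_idPr; rewrite -(expr0z ta) ler_weXz2l// ltW.
  have j1 : j + 1 <= 0 by lia.
  rewrite /G !h1 ?(ltW j0)// !h2 ?(ltW j0)//.
  rewrite expfzDr ?gt_eqF// expr1z.
  have -> : A * (ta ^ j * ta) - B * 1 - (A * ta ^ j - B * 1) = ta ^ j.
    by rewrite /A; field; rewrite subr_eq0 gt_eqF.
  by rewrite /grid_term ler_pdivrMr ?addr_gt0// ler_peMr ?(ltW (taz_gt0 _))// lerDl ltW.
exists (A + B) => m n.
have -> : grid_sum m n <= A + B.
  apply: (@le_trans _ _ (G (n%:Z - m) - G (- m))).
    elim: n => [|n IH]; first by rewrite /grid_sum big_ord0 add0r subrr.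
    rewrite /grid_sum big_ord_recr/=.
    have := Gincr (n%:Z - m).
    have -> : n%:Z - m + 1 = n.+1%:Z - m by rewrite -[n.+1]addn1 PoszD; ring.
    move: IH; rewrite /grid_sum; lra.
  have := GA (n%:Z - m); have := GB (- m); lra.
by [].
Qed.
End GeometricGrid.

Lemma grid_sum_sub {R : realType} (th ta : R) : 0 < ta -> 0 < th ->
  forall (m0 m d : int) (n0 n : nat), (m0 + d = m)%R -> 0 <= d ->
  d + n0%:Z <= n%:Z -> grid_sum th ta m0 n0 <= grid_sum th ta m n.
Proof.
move=> ta0 th0 m0 m d n0 n <- d0 dn.
case: d d0 dn => // d _ dn.
have le_dn : (d + n0 <= n)%N by lia.
have tp k : 0 <= grid_term th ta k.
  by rewrite divr_ge0 ?addr_ge0 ?exprz_ge0 ?ltW.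
rewrite /grid_sum.
rewrite -!(big_mkord xpredT (fun i => grid_term th ta (i%:Z - _))).
rewrite (big_cat_nat (leq0n _) le_dn)/=.
rewrite (big_cat_nat (leq0n d) (leq_addr n0 d))/=.
have -> : \sum_(0 <= i < n0) grid_term th ta (i%:Z - m0) =
   \sum_(d <= i < d + n0) grid_term th ta (i%:Z - (m0 + d%:Z)).
  transitivity (\sum_(0 + d <= i < d + n0) grid_term th ta (i%:Z - (m0 + d%:Z))) => //.
  rewrite big_addn addKn; apply: eq_bigr => i _; congr grid_term.
  by rewrite PoszD; ring.
rewrite -addrA addrCA lerDl addr_ge0// sumr_ge0//.
Qed.

Lemma exprz_bracket {R : realType} (th x : R) : 1 < th -> 0 < x ->
  exists k : int, th ^ k <= x < th ^ (k + 1).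
Proof.
move=> th1 x0; have th0 : 0 < th by exact: lt_trans th1.
have l0 : 0 < ln th by rewrite ln_gt0.
exists (Num.floor (ln x / ln th)).
have /andP[h1 h2] := floor_itv (ln x / ln th).
have E z : th ^ z = expR (z%:~R * ln th).
  by rewrite -powR_intmul ?ltW// /powR gt_eqF.
rewrite !E -{2 3}(lnK (x:=x)) ?posrE// ler_expR ltr_expR.
by rewrite -ler_pdivlMr// -ltr_pdivrMr// h1.
Qed.

(** With [p = r - 1] and [K = ta * sup grid_sum], comparing [x] with the two
    neighbouring powers of [th] shows that [grid_fun x / K] is at most [x ^ p]
    and, once the grid covers enough scales, at least
    [(1 - e) / ta ^ 2 * x ^ p]. Taking [ta] near [1] makes the loss small.
    Small [x] need no grid because [x ^ r] is itself small there. For [r = 2]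
    one fraction with [al = 0] is enough. *)
Lemma powR_quadratic_fractions {R : realType} (r N eps : R) :
  1 < r -> r <= 2 -> 0 < eps -> exists s : seq (R * R),
  [/\ forall i, i \in s -> 0 <= i.1 /\ 0 < i.2,
      forall x, 0 <= x -> \sum_(i <- s) x ^+ 2 / (i.1 * x + i.2) <= x `^ r
    & forall x, 0 <= x <= N ->
        x `^ r <= \sum_(i <- s) x ^+ 2 / (i.1 * x + i.2) + eps].
Proof.
move=> r1 r2 e0.
have [->|rn2] := eqVneq r 2.
  exists [:: (0, 1)]; split => [i||x].
  - by rewrite inE => /eqP ->/=.
  - by move=> x x0; rewrite big_seq1/= mul0r add0r divr1 powR_mulrn.
  - by move=> /andP[x0 _]; rewrite big_seq1/= mul0r add0r divr1 powR_mulrn// lerDl ltW.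
have {r2 rn2} r2 : r < 2 by rewrite lt_neqAle rn2.
wlog N1 : N / 1 <= N.
  move=> /(_ (Num.max 1 N)) [|s [s1 s2 s3]]; first by rewrite le_max lexx.
  exists s; split => // x /andP[x0 xN]; apply: s3.
  by rewrite x0 le_max xN orbT.
pose p := r - 1.
have p0 : 0 < p by rewrite /p; lra.
have p1 : p < 1 by rewrite /p; lra.
have N0 : 0 < N by lra.
pose e := Num.min (2^-1) (eps / (3 * N ^+ 2)).
have e_gt0 : 0 < e by rewrite lt_min invr_gt0 ltr0n/= divr_gt0// mulr_gt0 ?exprn_gt0.
have e_le : e <= 2^-1 by rewrite ge_min lexx.
have e_le' : 3 * N ^+ 2 * e <= eps.
  rewrite mulrC -ler_pdivlMr ?mulr_gt0 ?exprn_gt0//.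
  by rewrite ge_min lexx orbT.
pose ta : R := 1 + e; pose th : R := ta `^ (p^-1).
have ta1 : 1 < ta by rewrite /ta; lra.
have ta0 : 0 < ta by rewrite /ta; lra.
have tath : ta < th.
  rewrite /th -{1}(powRr1 (ltW ta0)) /powR gt_eqF// ltr_expR ltr_pM2r ?ln_gt0//.
  by rewrite invf_gt1.
have th1 : 1 < th by lra.
have th0 : 0 < th by lra.
have thp (k : int) : (th ^ k) `^ p = ta ^ k.
  rewrite -!powR_intmul ?ltW// -powRrM mulrC powRrM /th -(powRrM ta) mulVf ?gt_eqF//.
  by rewrite powRr1// ltW.
pose E := [set y | exists m n, y = grid_sum th ta m n].
have E1 : E (grid_sum th ta 0 1) by exists 0, 1%N.
have supE : has_sup E.
  split; first by exists (grid_sum th ta 0 1).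
  have [C HC] := grid_sum_bounded ta1 tath.
  by exists C => _ [m [n ->]].
pose S := sup E.
have US m n : grid_sum th ta m n <= S.
  by apply: ub_le_sup; [case: supE|exists m, n].
have S0 : 0 < S.
  apply: lt_le_trans (US 0 1%N).
  by rewrite /grid_sum big_ord_recl big_ord0 addr0 grid_term_gt0.
pose K : R := ta * S.
have K0 : 0 < K by rewrite mulr_gt0.
have upper m n (x : R) : 0 <= x -> grid_fun th ta m n x / K <= x `^ p.
  rewrite le_eqVlt => /orP[/eqP <-|x0].
    rewrite powR0 ?gt_eqF// /grid_fun big1 ?mul0r// => i _.
    by rewrite mulr0 mul0r.
  have [k /andP[k1 k2]] := exprz_bracket th1 x0.
  have h := grid_fun_homo ta1 tath m n x0 (ltW k2).
  rewrite (grid_fun_scale ta1 tath) in h.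
  apply: (@le_trans _ _ (ta ^ k)).
    rewrite ler_pdivrMr//; apply: (le_trans h).
    rewrite expfzDr ?gt_eqF// expr1z /K mulrA ler_pM2l ?US//.
    by rewrite mulr_gt0 ?exprz_gt0.
  by rewrite -thp ge0_ler_powR ?nnegrE ?exprz_ge0 //; exact: ltW.
(* Below [d] the value [x ^ r] is at most [eps]; the grid is chosen to cover
   the scales between [d] and [N]. *)
pose d := eps / N.
have d0 : 0 < d by rewrite divr_gt0.
have [k1 /andP[k1l k1u]] := exprz_bracket th1 d0.
have [k2 /andP[k2l k2u]] := exprz_bracket th1 N0.
have [_ [m0 [n0 ->]] hS] : exists2 y, E y & S - e * S < y.
  by apply: sup_adherent => //; rewrite mulr_gt0.
pose m : int := m0 - k1; pose n := (n0 + `|k2 - k1|)%N.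
have lower x : d <= x <= N -> x `^ p <= grid_fun th ta m n x / K + 3 * N * e.
  move=> /andP[dx xN]; have x0 : 0 < x by apply: lt_le_trans dx.
  have [k /andP[kl ku]] := exprz_bracket th1 x0.
  have kk1 : k1 <= k.
    rewrite -ltzD1 -(ltr_eXz2l th1).
    by apply: le_lt_trans k1l (le_lt_trans dx ku).
  have kk2 : k <= k2.
    rewrite -ltzD1 -(ltr_eXz2l th1).
    by apply: le_lt_trans kl (le_lt_trans xN k2u).
  have h := grid_fun_homo ta1 tath m n (exprz_gt0 k th0) kl.
  rewrite (grid_fun_scale ta1 tath) in h.
  have h2 : grid_sum th ta m0 n0 <= grid_sum th ta (m + k) n.
    apply: (@grid_sum_sub _ _ _ ta0 th0 _ _ (k - k1)); rewrite /m /n.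
    - by rewrite addrA addrAC.
    - by rewrite subr_ge0.
    - rewrite PoszD gez0_abs ?subr_ge0 ?(le_trans kk1)// [leRHS]addrC.
      by rewrite !lerD2r.
  have xp : x `^ p <= ta ^ k * ta.
    rewrite -{2}(expr1z ta) -expfzDr ?gt_eqF// -thp.
    by rewrite ge0_ler_powR ?nnegrE ?exprz_ge0 //; exact: ltW.
  have xpN : x `^ p <= N.
    apply: (@le_trans _ _ (N `^ p)).
      by rewrite ge0_ler_powR ?nnegrE//; exact: ltW.
    by rewrite -{2}(powRr1 (ltW N0)) ler_powR// ltW.
  have tk0 : 0 < ta ^ k by exact: exprz_gt0.
  have : ta ^ k * ((1 - e) * S) <= grid_fun th ta m n x.
    apply: le_trans h; rewrite ler_pM2l//; apply: le_trans h2.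
    by move: hS; lra.
  rewrite -lerBlDr ler_pdivlMr// /K => h3; apply: le_trans h3.
  rewrite !mulrA ler_pM2r//.
  have xp0 : 0 <= x `^ p by exact: powR_ge0.
  have : (x `^ p - 3 * N * e) <= x `^ p * (1 - 3 * e) by nra.
  move: xp; rewrite /ta; move: (ta ^ k) tk0 (x `^ p) xp0 xpN => u u0 v v0 vN uv.
  move=> hh; apply: (@le_trans _ _ (v * (1 - 3 * e) * (1 + e))).
    by rewrite ler_pM2r//; lra.
  have -> : v * (1 - 3 * e) * (1 + e) = v * ((1 - 3 * e) * (1 + e)) by ring.
  apply: (@le_trans _ _ (v * ((1 - e) / (1 + e)))).
    apply: ler_wpM2l => //; rewrite ler_pdivlMr; last lra.
    nra.
  rewrite mulrA ler_pdivrMr; last lra.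
  have : 0 <= 1 - e by lra.
  nra.
have xr x : 0 <= x -> x `^ r = x * x `^ p.
  by move=> x0; rewrite mulr_powRB1//; exact: lt_trans r1.
pose w (i : 'I_n) : R * R := let j := i%:Z - m in
  (K / ta ^ j, K * th ^ j / ta ^ j).
have wE x : 0 <= x -> \sum_(i <- map w (enum 'I_n)) x ^+ 2 / (i.1 * x + i.2)
     = x * (grid_fun th ta m n x / K).
  move=> x0; rewrite big_map big_enum/= /grid_fun mulrA mulrC mulrA mulr_sumr.
  apply: eq_bigr => i _; rewrite /w/=.
  have := exprz_gt0 (i%:Z - m) th0; have := exprz_gt0 (i%:Z - m) ta0.
  move: (ta ^ _) (th ^ _) => u v u0 v0.
  have xv : x + v != 0 by rewrite gt_eqF// ltr_wpDl.
  have -> : K / u * x + K * v / u = K / u * (x + v) by ring.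
  by field; rewrite xv !gt_eqF.
exists (map w (enum 'I_n)); split.
- by move=> _ /mapP[i _ ->]; rewrite /w/=; rewrite divr_ge0 ?divr_gt0 ?mulr_gt0 ?exprz_gt0// ?exprz_ge0// ltW.
- by move=> x x0; rewrite wE// xr// ler_wpM2l// upper.
move=> x /andP[x0 xN]; rewrite wE// xr//.
have gf0 : 0 <= grid_fun th ta m n x / K.
  apply: divr_ge0; last exact: ltW.
  apply: sumr_ge0 => i _; rewrite divr_ge0 ?mulr_ge0 ?addr_ge0 ?exprz_ge0// ltW//.
have [dx|xd] := leP d x.
  have := lower x; rewrite dx xN => /(_ isT) h.
  apply: (@le_trans _ _ (x * (grid_fun th ta m n x / K + 3 * N * e))).
    exact: ler_wpM2l.
  rewrite mulrDr lerD2l; apply: le_trans e_le'.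
  have -> : x * (3 * N * e) = (3 * e * N) * x by ring.
  have -> : 3 * N ^+ 2 * e = (3 * e * N) * N by ring.
  by rewrite ler_wpM2l// !mulr_ge0 ?ltW.
have xpN : x `^ p <= N.
  apply: (@le_trans _ _ (N `^ p)).
    by rewrite ge0_ler_powR ?nnegrE//; exact: ltW.
  by rewrite -{2}(powRr1 (ltW N0)) ler_powR// ltW.
have : x * x `^ p <= d * N by apply: ler_pM => //; rewrite ?powR_ge0 ?ltW.
have -> : d * N = eps by rewrite /d divfK ?gt_eqF.
move: (mulr_ge0 x0 gf0); lra.
Qed.

(** * Bernstein polynomials *)

Section Bernstein.
Context {R : realType} (N : R).
Implicit Types (f : R -> R) (g h : nat -> R) (n : nat) (x : R).

(** The mean of [g] at a binomial variable with parameters [n] and ['X / N],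
    by conditioning on the first trial. All the moments needed below follow
    from this recursion without binomial sums. *)
Fixpoint bern_rec g n : {poly R} :=
  if n is n'.+1 then
    (1 - (N^-1)%:P * 'X) * bern_rec g n' +
    (N^-1)%:P * 'X * bern_rec (fun k => g k.+1) n'
  else (g 0%N)%:P.

Lemma bern_rec_le g h n x : 0 <= x <= N ->
  (forall k, (k <= n)%N -> g k <= h k) -> (bern_rec g n).[x] <= (bern_rec h n).[x].
Proof.
move=> /andP[x0 xN]; have u0 : 0 <= N^-1 * x by rewrite mulr_ge0 ?invr_ge0// (le_trans x0).
have u1 : N^-1 * x <= 1.
  have [->|N0] := eqVneq N 0; first by rewrite invr0 mul0r.
  by rewrite mulrC ler_pdivrMr ?mul1r// lt_neqAle eq_sym N0 (le_trans x0).
elim: n g h => [|n IH] g h gh /=; first by rewrite !hornerC gh.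
rewrite !hornerE lerD// ler_wpM2l ?subr_ge0//.
- by apply: IH => k kn; apply: gh; apply: leq_trans kn _.
- by apply: IH => k kn; apply: gh.
Qed.

Lemma bern_recD g h n :
  bern_rec (fun k => g k + h k) n = bern_rec g n + bern_rec h n.
Proof. by elim: n g h => [|n IH] g h /=; rewrite ?polyCD// !IH; ring. Qed.

Lemma bern_recZ (c : R) g n :
  bern_rec (fun k => c * g k) n = c%:P * bern_rec g n.
Proof. by elim: n g => [|n IH] g /=; rewrite ?polyCM// !IH; ring. Qed.

Lemma eq_bern_rec g h n : (forall k, (k <= n)%N -> g k = h k) ->
  bern_rec g n = bern_rec h n.
Proof.
elim: n g h => [|n IH] g h gh /=; first by rewrite gh.
congr (_ * _ + _ * _); apply: IH => k kn; apply: gh => //.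
exact: leq_trans kn _.
Qed.

(** Positive on [[0, N]], and a partition of unity: the polynomials that
    replace spectral projections in the operator arguments. *)
Definition bern_basis n (k : nat) := bern_rec (fun j => (j == k)%:R) n.

Lemma bern_recE g n :
  bern_rec g n = \sum_(k < n.+1) g k *: bern_basis n k.
Proof.
have -> : bern_rec g n =
    bern_rec (fun j => \sum_(k < n.+1) g k * (j == k)%:R) n.
  apply: eq_bern_rec => j jn; rewrite (bigD1 (Ordinal (jn : (j < n.+1)%N)))//=.
  rewrite eqxx mulr1 big1 ?addr0// => i /eqP ij.
  by case: eqP => [e|]; rewrite ?mulr0//; case: ij; apply: val_inj.
elim: (index_enum _) => [|k s IH].
  rewrite big_nil; under eq_bern_rec do rewrite big_nil.
  by elim: n {g} => [//|n IH] /=; rewrite IH !mulr0 addr0.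
rewrite big_cons -IH -mul_polyC -bern_recZ -bern_recD.
by apply: eq_bern_rec => j _; rewrite big_cons.
Qed.

Lemma bern_basis_ge0 n k x : 0 <= x <= N -> 0 <= (bern_basis n k).[x].
Proof.
move=> xN; have <- : (bern_rec (fun=> 0) n).[x] = 0.
  rewrite -[RHS](hornerC 0 x); congr horner.
  by elim: n => [//|n IH] /=; rewrite IH !mulr0 addr0.
by apply: bern_rec_le => // j _.
Qed.

Lemma bern_rec_affine (a b : R) n :
  bern_rec (fun k => a + b * k%:R) n = a%:P + (b * n%:R / N)%:P * 'X.
Proof.
elim: n a => [|n IH] a /=.
  by rewrite !(mulr0, mul0r, polyC0, addr0).
rewrite IH (@eq_bern_rec _ (fun k => (a + b) + b * k%:R)); last first.
  by move=> k _; rewrite -(addn1 k) natrD; ring.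
by rewrite IH -(addn1 n) natrD; ring.
Qed.

Lemma bern_rec_square (A B y : R) n x :
  (bern_rec (fun k => A + B * (k%:R - y) ^+ 2) n).[x] =
  A + B * (n%:R * (x / N) * (1 - x / N) + (n%:R * (x / N) - y) ^+ 2).
Proof.
elim: n y => [|n IH] y /=.
  by rewrite hornerC; ring.
rewrite !hornerE IH (@eq_bern_rec _ (fun k => A + B * (k%:R - (y - 1)) ^+ 2)).
  by rewrite IH -(addn1 n) natrD/=; ring.
by move=> k _; rewrite -(addn1 k) natrD; ring.
Qed.

Definition node n (k : nat) := N * k%:R / n%:R.
Definition bernstein f n := bern_rec (fun k => f (node n k)) n.

Hypothesis N_gt0 : 0 < N.

Lemma node_itv n k : (0 < n)%N -> (k <= n)%N -> 0 <= node n k <= N.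
Proof.
move=> n0 kn; rewrite /node !mulr_ge0 ?invr_ge0 ?ler0n ?(ltW N_gt0)//=.
by rewrite ler_pdivrMr ?ltr0n// ler_pM2l// ler_nat.
Qed.

Lemma bern_basis_sum n : \sum_(k < n.+1) bern_basis n k = 1.
Proof.
have := bern_rec_affine 1 0 n; rewrite bern_recE !(mul0r, polyC0, addr0) -polyC1 => <-.
by apply: eq_bigr => k _; rewrite mul0r addr0 scale1r.
Qed.

Lemma bern_basis_node n : (0 < n)%N ->
  \sum_(k < n.+1) node n k *: bern_basis n k = 'X.
Proof.
move=> n0; have := bern_rec_affine 0 (N / n%:R) n.
rewrite bern_recE mulrVK ?unitfE ?pnatr_eq0 -?lt0n// divff ?gt_eqF// mul1r add0r => <-.
by apply: eq_bigr => k _; rewrite add0r /node mulrAC.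
Qed.

Lemma bernsteinE f n :
  bernstein f n = \sum_(k < n.+1) f (node n k) *: bern_basis n k.
Proof. exact: bern_recE. Qed.

(** Chebyshev's argument: [L * |u|] is at most [e / 2 + (L * u) ^ 2 / (2 * e)],
    and the mean of the square is the binomial variance. *)
Lemma bernstein_cvg f (L : R) :
  (forall x y, 0 <= x <= N -> 0 <= y <= N -> `|f x - f y| <= L * `|x - y|) ->
  forall e, 0 < e -> exists n0, forall n, (n0 < n)%N -> forall x, 0 <= x <= N ->
    `|(bernstein f n).[x] - f x| <= e.
Proof.
move=> fL e e0; pose C := L ^+ 2 * N ^+ 2 / e ^+ 2.
exists (Num.truncn C) => n nC x xN.
have n0 : 0 < n%:R :> R by rewrite ltr0n; case: n nC.
have {nC} nC : C < n%:R.
  by apply: lt_le_trans (truncnS_gt _) _; rewrite ler_nat.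
have nn0 : (0 < n)%N by move: n0; rewrite ltr0n.
pose q := L ^+ 2 * (N / n%:R) ^+ 2 / (2 * e).
have fk k : (k <= n)%N ->
    `|f (node n k) - f x| <= e / 2 + q * (k%:R - n%:R * (x / N)) ^+ 2.
  move=> kn; apply: le_trans (fL _ _ (node_itv nn0 kn) xN) _.
  have -> : q * (k%:R - n%:R * (x / N)) ^+ 2 = (L * (node n k - x)) ^+ 2 / (2 * e).
    by rewrite /q /node; field; rewrite !gt_eqF.
  rewrite exprMn -[(_ - x) ^+ 2]real_normK ?num_real// -exprMn.
  move: (L * _) => z; rewrite -subr_ge0.
  have -> : e / 2 + z ^+ 2 / (2 * e) - z = (z - e) ^+ 2 / (2 * e).
    by field; rewrite gt_eqF.
  by rewrite divr_ge0 ?sqr_ge0// mulr_ge0// ltW.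
have bound : q * (n%:R * (x / N) * (1 - x / N) + (n%:R * (x / N) - n%:R * (x / N)) ^+ 2) <= e / 2.
  rewrite subrr expr0n/= addr0.
  have u01 : (x / N) * (1 - x / N) <= 1.
    by move: (x / N) => u; have := sqr_ge0 (u - 2^-1); nra.
  have -> : q * (n%:R * (x / N) * (1 - x / N)) =
      (C / n%:R) * (x / N * (1 - x / N)) * (e / 2).
    by rewrite /q /C; field; rewrite !gt_eqF.
  rewrite ler_piMl ?divr_ge0 ?(ltW e0)//.
  have C0 : 0 <= C / n%:R.
    rewrite divr_ge0 ?ler0n// /C divr_ge0 ?sqr_ge0// mulr_ge0 ?sqr_ge0//.
  apply: (@le_trans _ _ (C / n%:R * 1)); first exact: ler_wpM2l.
  by rewrite mulr1 ler_pdivrMr// mul1r ltW.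
rewrite ler_distl; apply/andP; split.
- apply: (@le_trans _ _ (f x - e / 2 - e / 2)); first lra.
  apply: (@le_trans _ _ (bern_rec (fun k => (f x - e / 2) + (- q) * (k%:R - n%:R * (x / N)) ^+ 2) n).[x]).
    by rewrite bern_rec_square; move: bound; rewrite mulNr; lra.
  apply: bern_rec_le => // k kn; have := fk _ kn; rewrite ler_distl mulNr => /andP[]; lra.
- apply: (@le_trans _ _ (f x + e / 2 + e / 2)); last lra.
  apply: (@le_trans _ _ (bern_rec (fun k => (f x + e / 2) + q * (k%:R - n%:R * (x / N)) ^+ 2) n).[x]).
    apply: bern_rec_le => // k kn; have := fk _ kn; rewrite ler_distl => /andP[]; lra.
  by rewrite bern_rec_square lerD2l.
Qed.
End Bernstein.

(** From [x ^ r = x * x ^ p] with [p <= 1]; the map [x |-> x ^ p / x] is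
    nonincreasing, which bounds [y * (x ^ p - y ^ p)]. *)
Lemma powR_lipschitz {R : realType} (N r : R) : 0 < N -> 1 < r -> r <= 2 ->
  forall x y, 0 <= x <= N -> 0 <= y <= N ->
  `|x `^ r - y `^ r| <= 2 * N `^ (r - 1) * `|x - y|.
Proof.
move=> N0 r1 r2 x y.
wlog yx : x y / y <= x.
  move=> W; have [|/ltW] := leP y x; first exact: W.
  by move=> xy hx hy; rewrite distrC (distrC x); apply: W.
move=> /andP[x0 xN] /andP[y0 yN].
set p := r - 1.
have p0 : 0 < p by rewrite /p; lra.
have xr z : 0 <= z -> z `^ r = z * z `^ p.
  by move=> z0; rewrite mulr_powRB1//; exact: lt_trans r1.
have mono u v : 0 <= u -> u <= v -> u `^ p <= v `^ p.
  by move=> u0 uv; rewrite ge0_ler_powR ?nnegrE ?(ltW p0)//; exact: le_trans uv.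
have key : y * x `^ p <= x * y `^ p.
  move: y0; rewrite le_eqVlt => /orP[/eqP <-|y0]; first by rewrite mul0r mulr_ge0// powR_ge0.
  pose q := x / y; have xq : x = y * q by rewrite /q mulrC divfK// gt_eqF.
  have q1 : 1 <= q by rewrite ler_pdivlMr// mul1r.
  have q0 : 0 <= q by lra.
  have qp : q `^ p <= q by rewrite -{2}(powRr1 q0) ler_powR//; rewrite /p; lra.
  rewrite xq powRM ?(ltW y0)// mulrA [leRHS]mulrAC ler_wpM2l//.
  by rewrite mulr_ge0 ?powR_ge0// ltW.
rewrite !xr// !ger0_norm ?subr_ge0// ?ler_pM ?powR_ge0 ?mono//.
have := mono _ _ y0 yN; have := mono _ _ x0 xN.
move: key; move: (x `^ p) (y `^ p) (N `^ p) => a b c; nra.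
Qed.

Lemma fraction_lipschitz {R : realType} (N al be : R) : 0 <= al -> 0 < be ->
  forall x y, 0 <= x <= N -> 0 <= y <= N ->
  `|x / (al * x + be) - y / (al * y + be)| <= be^-1 * `|x - y|.
Proof.
move=> al0 be0 x y /andP[x0 _] /andP[y0 _].
have gx : be <= al * x + be by rewrite lerDr mulr_ge0.
have gy : be <= al * y + be by rewrite lerDr mulr_ge0.
have gx0 := lt_le_trans be0 gx; have gy0 := lt_le_trans be0 gy.
have -> : x / (al * x + be) - y / (al * y + be) =
   (be / ((al * x + be) * (al * y + be))) * (x - y).
  by field; rewrite !gt_eqF.
rewrite normrM ler_wpM2r// ger0_norm ?divr_ge0 ?mulr_ge0 ?(ltW be0) ?(ltW gx0) ?(ltW gy0)//.
rewrite ler_pdivrMr ?mulr_gt0// mulrC ler_pdivlMr//.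
by apply: ler_pM; rewrite // ltW.
Qed.

(** * Real quadratic forms of operators *)

Lemma le0_of_small {R : realType} (v C : R) : 0 <= C ->
  (forall e, 0 < e -> v <= e * C) -> v <= 0.
Proof.
move=> C0 h; apply/ler_addgt0Pr => e e0; rewrite add0r.
have C1 : 0 < C + 1 by rewrite ltr_wpDl.
apply: le_trans (h _ (divr_gt0 e0 C1)) _.
by rewrite mulrAC ler_pdivrMr// ler_wpM2l ?lerDl// ltW.
Qed.

Section HilbertReal.
Context {R : realType} {H : hilbertType R}.
Implicit Types (x y z : H) (c : R) (X Y S : H -> H).

Lemma Re_conj (z : R[i]) : complex.Re (Num.conj z) = complex.Re z.
Proof. by case: z. Qed.
Lemma Im_conj (z : R[i]) : complex.Im (Num.conj z) = - complex.Im z.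
Proof. by case: z. Qed.
Lemma Re_add (u v : R[i]) : complex.Re (u + v) = complex.Re u + complex.Re v.
Proof. by case: u; case: v. Qed.
Lemma Im_add (u v : R[i]) : complex.Im (u + v) = complex.Im u + complex.Im v.
Proof. by case: u; case: v. Qed.
Lemma Re_opp (u : R[i]) : complex.Re (- u) = - complex.Re u.
Proof. by case: u. Qed.
Lemma Im_opp (u : R[i]) : complex.Im (- u) = - complex.Im u.
Proof. by case: u. Qed.
Lemma Re_realM c (u : R[i]) : complex.Re (c%:C%C * u) = c * complex.Re u.
Proof. by case: u => a b /=; rewrite mul0r subr0. Qed.
Lemma Im_realM c (u : R[i]) : complex.Im (c%:C%C * u) = c * complex.Im u.
Proof. by case: u => a b /=; rewrite mul0r addr0. Qed.

Lemma dotDl x y z : dot (x + y) z = dot x z + dot y z.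
Proof. exact: linearDl. Qed.
Lemma dotDr x y z : dot z (x + y) = dot z x + dot z y.
Proof. exact: linearDr. Qed.
Lemma dotNl x y : dot (- x) y = - dot x y.
Proof. exact: linearNl. Qed.
Lemma dotNr x y : dot x (- y) = - dot x y.
Proof. exact: linearNr. Qed.
Lemma dotZl (a : R[i]) x y : dot (a *: x) y = a * dot x y.
Proof. exact: linearZl_LR. Qed.
Lemma dotZr (a : R[i]) x y : dot x (a *: y) = Num.conj a * dot x y.
Proof. exact: linearZr_LR. Qed.
Lemma dotC x y : dot x y = Num.conj (dot y x).
Proof. by rewrite [LHS]hermC expr0 mul1r. Qed.
Lemma dot0l x : dot (0 : H) x = 0.
Proof. exact: linear0l. Qed.

(** The real part of the inner product is a real inner product; the order on
    operators only involves it. *)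
Definition rdot x y : R := complex.Re (dot x y).
Definition rnorm x : R := complex.Re `|x|.

Lemma rdotC x y : rdot x y = rdot y x.
Proof. by rewrite /rdot dotC Re_conj. Qed.
Lemma rdotDl x y z : rdot (x + y) z = rdot x z + rdot y z.
Proof. by rewrite /rdot dotDl Re_add. Qed.
Lemma rdotDr x y z : rdot z (x + y) = rdot z x + rdot z y.
Proof. by rewrite /rdot dotDr Re_add. Qed.
Lemma rdotNl x y : rdot (- x) y = - rdot x y.
Proof. by rewrite /rdot dotNl Re_opp. Qed.
Lemma rdotNr x y : rdot x (- y) = - rdot x y.
Proof. by rewrite /rdot dotNr Re_opp. Qed.
Lemma rdotBl x y z : rdot (x - y) z = rdot x z - rdot y z.
Proof. by rewrite rdotDl rdotNl. Qed.
Lemma rdotBr x y z : rdot z (x - y) = rdot z x - rdot z y.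
Proof. by rewrite rdotDr rdotNr. Qed.
Lemma rdotZl c x y : rdot (c%:C%C *: x) y = c * rdot x y.
Proof. by rewrite /rdot dotZl Re_realM. Qed.
Lemma rdotZr c x y : rdot x (c%:C%C *: y) = c * rdot x y.
Proof. by rewrite rdotC rdotZl rdotC. Qed.
Lemma rdot0l x : rdot 0 x = 0.
Proof. by rewrite /rdot dot0l. Qed.
Lemma rdot0r x : rdot x 0 = 0.
Proof. by rewrite rdotC rdot0l. Qed.

Lemma rnormE x : `|x| = (rnorm x)%:C%C.
Proof.
have : 0 <= `|x| by exact: normr_ge0.
rewrite lecE /rnorm => /andP[/eqP/= h _].
by case: (`|x|) h => a b /= ->.
Qed.

Lemma rnorm_ge0 x : 0 <= rnorm x.
Proof. by have := normr_ge0 x; rewrite rnormE lecR. Qed.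

Lemma rdotxx x : rdot x x = rnorm x ^+ 2.
Proof.
by rewrite /rdot -sqr_norm_dot rnormE -rmorphXn.
Qed.

Lemma rnorm_eq0 x : rnorm x = 0 -> x = 0.
Proof. by move=> h; apply/eqP; rewrite -normr_eq0 rnormE h. Qed.

Lemma rnorm0 : rnorm (0 : H) = 0.
Proof. by rewrite /rnorm normr0. Qed.

Lemma rnormZ c x : rnorm (c%:C%C *: x) = `|c| * rnorm x.
Proof. by rewrite /rnorm normrZ normc_def/= expr0n/= addr0 sqrtr_sqr Re_realM. Qed.

Lemma rnormD x y : rnorm (x + y) <= rnorm x + rnorm y.
Proof. by have := ler_normD x y; rewrite !rnormE -rmorphD lecR. Qed.

Lemma rnormN x : rnorm (- x) = rnorm x.
Proof. by rewrite /rnorm normrN. Qed.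

Lemma rdot_rnorm x y : rdot x y <= rnorm x * rnorm y.
Proof.
have : rdot (x + y) (x + y) <= (rnorm x + rnorm y) ^+ 2.
  by rewrite rdotxx ler_sqr ?nnegrE ?addr_ge0 ?rnorm_ge0// rnormD.
rewrite rdotDl !rdotDr !rdotxx (rdotC y x); nra.
Qed.

Definition op_symmetric X := forall x y, dot (X x) y = dot x (X y).

Lemma symmetric_Im X x : op_symmetric X -> complex.Im (dot (X x) x) = 0.
Proof.
move=> sX; have := sX x x; rewrite [RHS]dotC => /(congr1 (@complex.Im R)).
rewrite Im_conj; lra.
Qed.

Lemma symmetric_rdot X x y : op_symmetric X -> rdot (X x) y = rdot x (X y).
Proof. by move=> sX; rewrite /rdot sX. Qed.

Lemma op_posP X : op_pos X <->
  forall x, complex.Im (dot (X x) x) = 0 /\ 0 <= rdot (X x) x.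
Proof.
split => [h x|h x]; first by have := h x; rewrite lecE => /andP[/eqP].
by have [h1 h2] := h x; rewrite lecE h1 eqxx.
Qed.

Lemma symmetric_pos X : op_symmetric X -> (forall x, 0 <= rdot (X x) x) -> op_pos X.
Proof. by move=> sX h; apply/op_posP => x; rewrite symmetric_Im. Qed.

Lemma op_pos_rdot X x : op_pos X -> 0 <= rdot (X x) x.
Proof. by move/op_posP/(_ x) => []. Qed.

Lemma linear_add X x y : linear X -> X (x + y) = X x + X y.
Proof. by move=> lX; rewrite -{1}(scale1r x) lX scale1r. Qed.
Lemma linear_0 X : linear X -> X 0 = 0.
Proof. by move=> lX; have := linear_add 0 0 lX; rewrite addr0 -{1}[X 0]addr0 => /addrI. Qed.
Lemma linear_scale X (a : R[i]) x : linear X -> X (a *: x) = a *: X x.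
Proof. by move=> lX; rewrite -(addr0 (a *: x)) lX linear_0// addr0. Qed.
Lemma linear_opp X x : linear X -> X (- x) = - X x.
Proof. by move=> lX; rewrite -scaleN1r linear_scale// scaleN1r. Qed.
Lemma linear_sub X x y : linear X -> X (x - y) = X x - X y.
Proof. by move=> lX; rewrite linear_add// linear_opp. Qed.

(** Polarization: a form that is real on the diagonal is hermitian. *)
Lemma op_pos_symmetric X : linear X -> op_pos X -> op_symmetric X.
Proof.
move=> lX /op_posP pX.
have im x : complex.Im (dot (X x) x) = 0 by have [] := pX x.
have key x y : complex.Im (dot (X x) y) + complex.Im (dot (X y) x) = 0.
  have := im (x + y); rewrite linear_add// !dotDl !dotDr !Im_add !im.
  by rewrite add0r addr0 addrC.
move=> x y; rewrite (dotC x).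
have h1 := key x y; have h2 := key x ('i%C *: y).
move: h2; rewrite linear_scale// dotZl dotZr.
move: h1; case: (dot (X x) y) => a b; case: (dot (X y) x) => c d /= h1.
move=> h2; apply/eqP; rewrite eq_complex/=; apply/andP; split; apply/eqP; lra.
Qed.

Definition opbound X c := forall x, rnorm (X x) <= c * rnorm x.

Lemma bounded_operatorP X : bounded_operator X <->
  linear X /\ exists2 c, 0 <= c & opbound X c.
Proof.
split=> [[lX cX]|[lX [c c0 hc]]]; split => //.
  pose f : {linear H -> H} := HB.pack X (GRing.isLinear.Build _ _ _ _ X lX).
  have : continuous f := cX.
  move=> /linear_bounded_continuous /linear_boundedP [M [Mr HM]].
  have [N [NM N0]] : exists N : R, M < N%:C%C /\ 0 <= N.
    exists (`|complex.Re M| + 1); split; last by rewrite addr_ge0.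
    have M0 : complex.Im M = 0.
      by move: Mr; rewrite realE !lecE/= => /orP[] /andP[/eqP].
    rewrite ltcE/= M0 eqxx/=; apply: le_lt_trans (ler_norm _) _.
    by rewrite ltrDl.
  exists N => // x; have := HM _ NM x.
  by rewrite !rnormE -rmorphM lecR.
pose f : {linear H -> H} := HB.pack X (GRing.isLinear.Build _ _ _ _ X lX).
have : continuous f; last by [].
apply/linear_bounded_continuous/linear_boundedP.
exists c%:C%C; split; first by rewrite ger0_real// lecR.
move=> a ca x; apply: (@le_trans _ _ (c%:C%C * `|x|)).
  by rewrite !rnormE -rmorphM lecR.
by rewrite ler_wpM2r// ltW.
Qed.

Lemma opnorm_le X c : opbound X c -> 0 <= c -> opnorm X <= c.
Proof.
move=> hX c0; rewrite /opnorm; set E := (X in sup X).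
apply: ge_sup.
  by exists (rnorm (X 0)), 0 => //=; rewrite normr0.
move=> _ [x /= x1 <-]; apply: le_trans (hX x) _.
move: x1; rewrite rnormE -(rmorph1 (real_complex R)) lecR => x1.
by rewrite ler_piMr.
Qed.

Lemma opnorm_bound X : bounded_operator X -> opbound X (opnorm X).
Proof.
move=> /bounded_operatorP[lX [c c0 hc]] x.
have [x0|x0] := eqVneq (rnorm x) 0.
  by rewrite (rnorm_eq0 x0) linear_0// rnorm0 mulr0.
have xp : 0 < rnorm x by rewrite lt_def x0 rnorm_ge0.
rewrite -ler_pdivrMr//.
have -> : rnorm (X x) / rnorm x = rnorm (X ((rnorm x)^-1%:C%C *: x)).
  by rewrite linear_scale// rnormZ ger0_norm ?invr_ge0 ?ltW// mulrC.
apply: ub_le_sup.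
  exists c => _ [y /= y1 <-]; apply: le_trans (hc y) _.
  move: y1; rewrite rnormE -(rmorph1 (real_complex R)) lecR => y1.
  by rewrite ler_piMr.
exists ((rnorm x)^-1%:C%C *: x) => //=.
by rewrite rnormE rnormZ ger0_norm ?invr_ge0 ?rnorm_ge0// mulVf// lexx.
Qed.

Lemma opnorm_ge0 X : bounded_operator X -> 0 <= opnorm X.
Proof.
move=> /bounded_operatorP[lX [c c0 hc]].
apply: ub_le_sup.
  exists c => _ [y /= y1 <-]; apply: le_trans (hc y) _.
  move: y1; rewrite rnormE -(rmorph1 (real_complex R)) lecR => y1.
  by rewrite ler_piMr.
by exists 0; [rewrite /= normr0 ler01|rewrite linear_0// normr0].
Qed.

(** By polarization [4 Re <S x, y>] is the difference of the form at [x + y]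
    and [x - y]; the parallelogram law and [y] parallel to [S x], of the norm
    of [x], give the bound. *)
Lemma symmetric_rnorm_le S c : linear S -> op_symmetric S ->
  (forall x, `|rdot (S x) x| <= c * rnorm x ^+ 2) -> 0 <= c -> opbound S c.
Proof.
move=> lS sS hS c0 x.
have [x0|x0] := eqVneq (rnorm x) 0.
  by rewrite (rnorm_eq0 x0) linear_0// rnorm0 mulr0.
have xp : 0 < rnorm x by rewrite lt_def x0 rnorm_ge0.
have [y0|y0] := eqVneq (rnorm (S x)) 0; first by rewrite y0 mulr_ge0 ?rnorm_ge0.
have yp : 0 < rnorm (S x) by rewrite lt_def y0 rnorm_ge0.
pose t := rnorm x / rnorm (S x).
pose y := t%:C%C *: S x.
have ny : rnorm y = rnorm x.
  by rewrite /y rnormZ ger0_norm /t ?divr_ge0 ?rnorm_ge0// divfK.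
have hSy : rdot (S x) y = rnorm x * rnorm (S x).
  by rewrite /y rdotZr rdotxx /t; field; exact: y0.
have hp := hS (x + y); have hm := hS (x - y).
have : rdot (S (x + y)) (x + y) - rdot (S (x - y)) (x - y) = 4 * (rnorm x * rnorm (S x)).
  rewrite linear_add// linear_sub// !rdotDl !rdotDr !rdotNl !rdotNr.
  by rewrite (symmetric_rdot y x sS) (rdotC y) hSy; ring.
have sum : rnorm (x + y) ^+ 2 + rnorm (x - y) ^+ 2 = 4 * rnorm x ^+ 2.
  rewrite -!rdotxx !rdotDl !rdotDr !rdotNl !rdotNr !rdotxx ny; ring.
move: hp hm; rewrite !ler_norml => /andP[_ hp] /andP[hm _] E.
have : 4 * (rnorm x * rnorm (S x)) <= 4 * (rnorm x * (c * rnorm x)).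
  rewrite -E; apply: (@le_trans _ _ (c * (rnorm (x + y) ^+ 2 + rnorm (x - y) ^+ 2))).
    by rewrite mulrDr; lra.
  by rewrite sum; lra.
by rewrite ler_pM2l// ler_pM2l.
Qed.

(** Cauchy-Schwarz inequality for the form of [S], obtained from its positivity
    at [x - c^-1 S x]. *)
Lemma op_pos_rnorm_sqr S c : linear S -> op_pos S -> 0 < c ->
  opbound S c -> forall x, rnorm (S x) ^+ 2 <= c * rdot (S x) x.
Proof.
move=> lS pS c0 hc x; have sS := op_pos_symmetric lS pS.
have := op_pos_rdot (x - c^-1%:C%C *: S x) pS.
rewrite linear_sub// linear_scale//.
rewrite !rdotDl !rdotDr !rdotNl !rdotNr !rdotZl !rdotZr.
rewrite (symmetric_rdot (S x) x sS) rdotxx.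
have : rdot (S (S x)) (S x) <= c * rnorm (S x) ^+ 2.
  apply: le_trans (rdot_rnorm _ _) _.
  by rewrite expr2 mulrA ler_wpM2r ?rnorm_ge0.
set a := rdot (S (S x)) _; set b := rdot (S x) x; set d := rnorm (S x) ^+ 2.
move=> ac h.
have : c^-1 * (c^-1 * a) <= c^-1 * d.
  by rewrite ler_pM2l ?invr_gt0// mulrC ler_pdivrMr// mulrC.
move=> h2; rewrite -ler_pdivrMl//; lra.
Qed.

End HilbertReal.

(** * Polynomials in an element of a C*-algebra *)

Section CstarBasics.
Context {R : realType} {H : hilbertType R} (A : cstarAlgebra H).
Implicit Types (x y z : H) (X Y S : H -> H) (a c : R[i]) (t : R).
Implicit Types (p q : {poly R[i]}) (f g : {poly R}).
Local Notation e := (cstar_one A).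

Lemma cstar_lin X : A X -> linear X.
Proof. by move=> /cstar_bounded[]. Qed.
Lemma cstar_zero : A 0.
Proof.
have := cstar_linear (-1) (cstar_one_in A) (cstar_one_in A).
by rewrite scaleN1r addNr.
Qed.
Lemma cstar_add X Y : A X -> A Y -> A (X + Y).
Proof. by move=> aX aY; rewrite -(scale1r X); apply: cstar_linear. Qed.
Lemma cstar_scale c X : A X -> A (c *: X).
Proof.
by move=> aX; rewrite -(addr0 (c *: X)); apply: cstar_linear => //; exact: cstar_zero.
Qed.
Lemma cstar_sub X Y : A X -> A Y -> A (X - Y).
Proof. by move=> aX aY; rewrite -scaleN1r addrC; apply: cstar_linear. Qed.
Lemma cstar_sum I (s : seq I) (F : I -> H -> H) :
  (forall i, A (F i)) -> A (\sum_(i <- s) F i).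
Proof.
move=> hF; elim: s => [|i s IH]; first by rewrite big_nil; exact: cstar_zero.
by rewrite big_cons; apply: cstar_add.
Qed.

Lemma one_in : A e. Proof. exact: cstar_one_in. Qed.
Lemma one_lin : linear e. Proof. exact: cstar_lin one_in. Qed.
Lemma onel X x : A X -> e (X x) = X x.
Proof. by move=> /cstar_mul1l /(congr1 (@^~ x)). Qed.
Lemma oner X x : A X -> X (e x) = X x.
Proof. by move=> /cstar_mul1r /(congr1 (@^~ x)). Qed.
Lemma onee x : e (e x) = e x. Proof. exact: onel one_in. Qed.

(** The adjoint [s] of the identity [e] satisfies [s = e s], hence
    [<e x, y> = <s x, s y>], which is hermitian. *)
Lemma one_symmetric : op_symmetric e.
Proof.
have [s As adj] := cstar_adjoint one_in.
have key x y : dot (e x) y = dot (s x) (s y).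
  rewrite adj -{1}(onel y As) dotC adj -dotC; done.
by move=> x y; rewrite key [RHS]dotC key -dotC.
Qed.

Lemma rdot_one x : rdot (e x) x = rnorm (e x) ^+ 2.
Proof. by rewrite -rdotxx -{1}onee (symmetric_rdot _ _ one_symmetric). Qed.

Lemma one_pos : op_pos e.
Proof.
apply: symmetric_pos; first exact: one_symmetric.
by move=> x; rewrite rdot_one sqr_ge0.
Qed.

Lemma one_rnorm x : rnorm (e x) <= rnorm x.
Proof.
have [->|h] := eqVneq (rnorm (e x)) 0; first exact: rnorm_ge0.
have h0 : 0 < rnorm (e x) by rewrite lt_def h rnorm_ge0.
rewrite -(ler_pM2l h0) -expr2 -rdot_one; exact: rdot_rnorm.
Qed.

Lemma rdot_one_le x : rdot (e x) x <= rnorm x ^+ 2.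
Proof. by rewrite rdot_one ler_sqr ?nnegrE ?rnorm_ge0// one_rnorm. Qed.

(** Operators of the algebra live in the corner cut out by its identity. *)
Lemma rdot_corner X x : A X -> rdot (X x) x = rdot (X (e x)) (e x).
Proof.
by move=> aX; rewrite oner// -{1}(onel x aX) (symmetric_rdot _ _ one_symmetric).
Qed.

Lemma rdot_le_opnorm X x : A X -> rdot (X x) x <= opnorm X * rdot (e x) x.
Proof.
move=> aX; rewrite rdot_corner//; apply: le_trans (rdot_rnorm _ _) _.
rewrite rdot_one expr2 mulrA ler_wpM2r ?rnorm_ge0//.
exact: opnorm_bound (cstar_bounded aX) _.
Qed.

Lemma fun_sumE I (s : seq I) (F : I -> H -> H) x :
  (\sum_(i <- s) F i) x = \sum_(i <- s) F i x.
Proof. by elim: s => [|i s IH]; rewrite ?big_nil// !big_cons -IH. Qed.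

Variables (X : H -> H) (aX : A X).

Lemma op_expn_in n : A (op_expn A X n).
Proof.
by elim: n => [|n IH]; [exact: one_in|exact: (cstar_mul aX IH)].
Qed.

(** Complex coefficients are needed to split a polynomial into linear factors. *)
Definition cpoly p : H -> H := \sum_(i < size p) p`_i *: op_expn A X i.

Lemma cpoly_wide n p : (size p <= n)%N ->
  cpoly p = \sum_(i < n) p`_i *: op_expn A X i.
Proof.
move=> pn; rewrite /cpoly (big_ord_widen _ (fun i => p`_i *: op_expn A X i) pn).
rewrite big_mkcond/=; apply: eq_bigr => i _; case: ltnP => // pi.
by rewrite nth_default// scale0r.
Qed.

Lemma cpolyD p q : cpoly (p + q) = cpoly p + cpoly q.
Proof.
rewrite (cpoly_wide (size_polyD p q)) (cpoly_wide (leq_maxl (size p) (size q))).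
rewrite (cpoly_wide (leq_maxr (size p) (size q))) -big_split/=.
by apply: eq_bigr => i _; rewrite coefD scalerDl.
Qed.

Lemma cpolyC c : cpoly c%:P = c *: e.
Proof.
rewrite (cpoly_wide (size_polyC_leq1 c)) big_ord_recl big_ord0 addr0.
by rewrite coefC eqxx.
Qed.

Lemma cpolyZ c p : cpoly (c *: p) = c *: cpoly p.
Proof.
rewrite (cpoly_wide (size_scale_leq c p)) /cpoly scaler_sumr.
by apply: eq_bigr => i _; rewrite coefZ scalerA.
Qed.

Lemma cpoly_in p : A (cpoly p).
Proof. by apply: cstar_sum => i; apply/cstar_scale/op_expn_in. Qed.

Lemma cpolyMX p : cpoly (p * 'X) = X \o cpoly p.
Proof.
apply/funext => x /=; have lX := cstar_lin aX.
rewrite (@cpoly_wide (size p).+1); last first.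
  by apply: leq_trans (size_polyMleq _ _) _; rewrite size_polyX addn2.
rewrite big_ord_recl/= coefMX eqxx scale0r add0r /cpoly !fun_sumE.
rewrite (_ : X _ = \sum_(i < size p) X (p`_i *: op_expn A X i x)).
  apply: eq_bigr => i _; rewrite coefMX/= linear_scale//.
elim: (index_enum _) => [|i s IH]; first by rewrite !big_nil linear_0.
by rewrite !big_cons linear_add// IH.
Qed.

Lemma cpolyM p q : cpoly (p * q) = cpoly p \o cpoly q.
Proof.
elim/poly_ind: p => [|p c IH].
  by rewrite mul0r -polyC0 cpolyC scale0r.
rewrite mulrDl mulrAC !cpolyD !cpolyMX IH mul_polyC cpolyZ cpolyC.
by apply/funext => x; rewrite /= !fctE /= onel//; exact: cpoly_in.
Qed.

Lemma op_polyE f : op_poly A X f = cpoly (map_poly (real_complex R) f).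
Proof.
by rewrite /op_poly /cpoly size_map_poly; apply: eq_bigr => i _; rewrite coef_map.
Qed.

Lemma op_poly_in f : A (op_poly A X f).
Proof. by rewrite op_polyE; exact: cpoly_in. Qed.
Lemma op_polyD f g : op_poly A X (f + g) = op_poly A X f + op_poly A X g.
Proof. by rewrite !op_polyE rmorphD cpolyD. Qed.
Lemma op_polyZ t f : op_poly A X (t *: f) = t%:C%C *: op_poly A X f.
Proof. by rewrite !op_polyE map_polyZ cpolyZ. Qed.
Lemma op_polyN f : op_poly A X (- f) = - op_poly A X f.
Proof. by rewrite -scaleN1r op_polyZ rmorphN1 scaleN1r. Qed.
Lemma op_polyB f g : op_poly A X (f - g) = op_poly A X f - op_poly A X g.
Proof. by rewrite op_polyD op_polyN. Qed.
Lemma op_polyC t : op_poly A X t%:P = t%:C%C *: e.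
Proof. by rewrite op_polyE map_polyC cpolyC. Qed.
Lemma op_polyM f g : op_poly A X (f * g) = op_poly A X f \o op_poly A X g.
Proof. by rewrite !op_polyE rmorphM cpolyM. Qed.
Lemma op_polyX : op_poly A X 'X = X.
Proof.
rewrite -(mul1r 'X) op_polyE rmorphM/= map_polyX cpolyMX rmorph1 -polyC1 cpolyC.
by rewrite scale1r; apply/funext => x /=; rewrite oner.
Qed.
Lemma op_poly_sum I (s : seq I) (F : I -> {poly R}) :
  op_poly A X (\sum_(i <- s) F i) = \sum_(i <- s) op_poly A X (F i).
Proof.
elim: s => [|i s IH]; last by rewrite !big_cons op_polyD IH.
by rewrite !big_nil -polyC0 op_polyC scale0r.
Qed.

Lemma op_poly_symmetric f : op_symmetric X -> op_symmetric (op_poly A X f).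
Proof.
move=> sX; elim/poly_ind: f => [|f t IH] x y.
  rewrite -polyC0 op_polyC scale0r.
  by change (dot (0 : H) y = dot x (0 : H)); rewrite (dotC x) !dot0l rmorph0.
rewrite op_polyD op_polyC !fctE dotDl dotDr dotZl dotZr.
congr (_ + _).
  by rewrite mulrC {1}op_polyM op_polyX /= sX IH mulrC op_polyM op_polyX.
by rewrite one_symmetric; congr (_ * _); apply/eqP; rewrite eq_complex/= oppr0 !eqxx.
Qed.

End CstarBasics.

(** * Completeness and inverses *)

Section Complete.
Context {R : realType} {H : hilbertType R}.

Lemma rnorm_cauchy_cvg (u : nat -> H) :
  (forall e : R, 0 < e -> exists N, forall n d, (N <= n)%N ->
     rnorm (u (n + d)%N - u n) <= e) ->
  exists l : H, u @ \oo --> l.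
Proof.
move=> hu; suff : cvg (u @ \oo) by move=> c; exists (lim (u @ \oo)).
apply/cauchy_cvgP/cauchy_exP => e e0.
have [r0 er] : 0 < complex.Re e /\ e = (complex.Re e)%:C%C.
  by move: e0; rewrite ltcE => /andP[/eqP/= h r0]; split => //; case: e h r0 => a b /= ->.
have r20 : 0 < complex.Re e / 2 by rewrite divr_gt0.
have [N hN] := hu _ r20.
exists (u N); suff : \forall n \near \oo, ball (u N) e (u n) by [].
exists N => // n /= Nn.
rewrite -ball_normE/= -normrN opprB rnormE er ltcR.
rewrite -(subnKC Nn); apply: le_lt_trans (hN _ _ (leqnn N)) _.
by rewrite ltr_pdivrMr// mulr_natr mulr2n ltrDr.
Qed.

Lemma cvg_rnorm (u : nat -> H) (l : H) : u @ \oo --> l ->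
  forall e : R, 0 < e -> exists N, forall n, (N <= n)%N -> rnorm (u n - l) <= e.
Proof.
move=> /cvgrPdist_le ul e e0.
have [|N _ hN] := ul e%:C%C; first by rewrite ltcR.
exists N => n Nn; have := hN n Nn.
by rewrite -normrN opprB rnormE lecR.
Qed.

Variable A : cstarAlgebra H.
Local Notation "'1A'" := (cstar_one A).

(** The pointwise limit exists because the Hilbert space is complete, and lies
    in the algebra because the algebra is norm closed. *)
Lemma cstar_complete (Z : nat -> H -> H) : (forall n, A (Z n)) ->
  (forall e, 0 < e -> exists N, forall n d, (N <= n)%N ->
      opbound (Z (n + d)%N - Z n) e) ->
  exists2 Y, A Y & forall e, 0 < e -> exists N, forall n, (N <= n)%N ->
      opbound (Z n - Y) e.
Proof.
move=> AZ hZ.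
have cvgZ x : exists l : H, (fun n => Z n x) @ \oo --> l.
  apply: rnorm_cauchy_cvg => e e0.
  have e1 : 0 < e / (rnorm x + 1) by rewrite divr_gt0// ltr_wpDl ?rnorm_ge0.
  have [N hN] := hZ _ e1; exists N => n d Nn.
  apply: le_trans (hN n d Nn x) _.
  rewrite mulrAC ler_pdivrMr ?ltr_wpDl ?rnorm_ge0// ler_wpM2l// ?ltW//.
  by rewrite ltrDl.
pose Y x := sval (cid (cvgZ x)).
have hY x : (fun n => Z n x) @ \oo --> Y x by rewrite /Y; case: cid.
have lY : linear Y.
  move=> a x y.
  have h1 : (fun n => a *: Z n x + Z n y) @ \oo --> a *: Y x + Y y.
    by apply: cvgD => //; apply: cvgZr.
  have h2 := hY (a *: x + y).
  have E : (fun n => Z n (a *: x + y)) = (fun n => a *: Z n x + Z n y).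
    by apply/funext => n; rewrite (cstar_lin (AZ n)).
  rewrite E in h2; exact: (cvg_unique (@norm_hausdorff _ _) h2 h1).
have bY e : 0 < e -> exists N, forall n, (N <= n)%N -> opbound (Z n - Y) e.
  move=> e0; have [N hN] := hZ _ e0; exists N => n Nn x.
  apply/ler_addgt0Pr => k k0.
  have [M hM] := cvg_rnorm (hY x) k0.
  have -> : (Z n - Y) x = - ((Z (n + M)%N - Z n) x) + (Z (n + M)%N x - Y x).
    by rewrite !fctE opprB addrA subrK.
  apply: le_trans (rnormD _ _) _; rewrite rnormN lerD ?hM ?leq_addl//.
  exact: hN.
have bdY : bounded_operator Y.
  apply/bounded_operatorP; split => //.
  have [N hN] := bY _ ltr01.
  exists (opnorm (Z N) + 1).
    by rewrite addr_ge0// opnorm_ge0//; exact: cstar_bounded (AZ N).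
  move=> x; have -> : Y x = Z N x - (Z N - Y) x by rewrite !fctE opprB addrC subrK.
  apply: le_trans (rnormD _ _) _; rewrite rnormN mulrDl lerD//; last exact: hN.
  exact: opnorm_bound (cstar_bounded (AZ N)) _.
exists Y => //; apply: cstar_closed => // e e0.
have e20 : 0 < e / 2 by rewrite divr_gt0.
have [N hN] := bY _ e20.
exists (Z N) => //; apply: (@le_lt_trans _ _ (e / 2)).
  apply: opnorm_le; last exact: ltW.
  move=> x; rewrite -rnormN; have := hN _ (leqnn N) x.
  by rewrite !fctE opprB.
by rewrite ltr_pdivrMr// mulr_natr mulr2n ltrDr.
Qed.

(** The inverse is the sum of the powers of [T]. *)
Lemma neumann_invertible (T : H -> H) (rho : R) : A T -> 0 <= rho -> rho < 1 ->
  opbound T rho -> exists2 W, A W & (1A - T) \o W = 1A /\ W \o (1A - T) = 1A.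
Proof.
move=> AT r0 r1 hT.
have hTn n : opbound (op_expn A T n) (rho ^+ n).
  elim: n => [|n IH] x; first by rewrite expr0 mul1r one_rnorm.
  apply: le_trans (hT _) _; rewrite exprS -mulrA ler_wpM2l//; exact: IH.
pose f n : {poly R} := \sum_(i < n) 'X^i.
pose Z n := op_poly A T (f n).
have TX n : op_poly A T 'X^n = op_expn A T n.
  elim: n => [|n IH]; first by rewrite expr0 -polyC1 op_polyC// scale1r.
  by rewrite exprS op_polyM// op_polyX// IH.
have ZS n : Z n.+1 = Z n + op_expn A T n.
  by rewrite /Z /f big_ord_recr/= op_polyD// TX.
have Z1 n : op_poly A T ((1 - 'X) * f n) = 1A - op_expn A T n.
  by rewrite /f -opprB mulNr -subrX1 opprB op_polyB// TX -polyC1 op_polyC// scale1r.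
have T1 : op_poly A T (1 - 'X) = 1A - T.
  by rewrite op_polyB// op_polyX// -polyC1 op_polyC// scale1r.
have r1' : 0 < 1 - rho by rewrite subr_gt0.
have Zd n d : opbound (Z (n + d)%N - Z n) ((rho ^+ n - rho ^+ (n + d)) / (1 - rho)).
  elim: d => [|d IH] x.
    by rewrite addn0 !subrr !mul0r; change (rnorm (0 : H) <= 0); rewrite rnorm0.
  rewrite addnS ZS.
  have -> : (Z (n + d)%N + op_expn A T (n + d) - Z n) x =
     (Z (n + d)%N - Z n) x + op_expn A T (n + d) x by rewrite !fctE addrAC.
  apply: le_trans (rnormD _ _) (le_trans (lerD (IH x) (hTn _ x)) _).
  rewrite -mulrDl; apply: ler_wpM2r; first exact: rnorm_ge0.
  by rewrite le_eqVlt; apply/orP; left; apply/eqP; rewrite exprS; field; rewrite gt_eqF.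
have small e : 0 < e -> exists N, forall n, (N <= n)%N -> rho ^+ n <= e.
  move=> e0; have : (rho ^+ n) @[n --> \oo] --> (0 : R).
    by apply: cvg_expr; rewrite ger0_norm.
  move=> /cvgrPdist_le/(_ _ e0)[N _ hN]; exists N => n Nn.
  have := hN n Nn; rewrite /= sub0r normrN ger0_norm// exprn_ge0//.
have AZ n : A (Z n) by exact: op_poly_in.
have [|W AW hW] := cstar_complete AZ.
  move=> e e0; have [|N hN] := small (e * (1 - rho)); first by rewrite mulr_gt0.
  exists N => n d Nn x; apply: le_trans (Zd n d x) _.
  rewrite ler_wpM2r ?rnorm_ge0// ler_pdivrMr//.
  by apply: le_trans (hN _ Nn); rewrite gerBl exprn_ge0.
have A1T : A (1A - T) by apply: cstar_sub => //; exact: one_in.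
have b1 := opnorm_bound (cstar_bounded A1T).
have b1_ge0 := opnorm_ge0 (cstar_bounded A1T).
have l1 := cstar_lin A1T.
set b := opnorm (1A - T) in b1 b1_ge0.
exists W => //; split; apply/funext => x; apply/eqP; rewrite -subr_eq0; apply/eqP;
  apply: rnorm_eq0; apply/eqP; rewrite eq_le rnorm_ge0 andbT;
  apply: (@le0_of_small _ _ ((b + 1) * rnorm x)) => [|e e0];
  rewrite ?mulr_ge0 ?addr_ge0 ?rnorm_ge0//;
  have [N1 h1] := hW _ e0; have [N2 h2] := small _ e0;
  pose n := (N1 + N2)%N;
  have k2 := le_trans (hTn n x) (ler_wpM2r (rnorm_ge0 x) (h2 n (leq_addl _ _)));
  have -> : e * ((b + 1) * rnorm x) = b * (e * rnorm x) + e * rnorm x by ring.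
- have E : (1A - T) (Z n x) = 1A x - op_expn A T n x.
    by have /(congr1 (@^~ x)) := Z1 n; rewrite op_polyM// T1.
  have -> : ((1A - T) \o W) x - 1A x = - ((1A - T) ((Z n - W) x)) - op_expn A T n x.
    rewrite [(Z n - W) x]/(Z n x - W x) (linear_sub _ _ l1) opprB E.
    by rewrite opprB addrA addrAC addrK.
  apply: le_trans (rnormD _ _) _; rewrite !rnormN; apply: lerD => //.
  exact: le_trans (b1 _) (ler_wpM2l b1_ge0 (h1 n (leq_addr _ _) x)).
- have E : Z n ((1A - T) x) = 1A x - op_expn A T n x.
    by have /(congr1 (@^~ x)) := Z1 n; rewrite mulrC op_polyM// T1.
  have -> : (W \o (1A - T)) x - 1A x = - ((Z n - W) ((1A - T) x)) - op_expn A T n x.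
    rewrite [(Z n - W) _]/(Z n ((1A - T) x) - W ((1A - T) x)) opprB E.
    by rewrite opprB addrA addrAC addrK.
  apply: le_trans (rnormD _ _) _; rewrite !rnormN; apply: lerD => //.
  apply: le_trans (h1 n (leq_addr _ _) _) _.
  by rewrite mulrCA ler_wpM2l ?(ltW e0)//; exact: b1.
Qed.

(** [1 - S / C] with [C] large is positive and at most [1 - d / C], hence a
    strict contraction. *)
Lemma strictly_pos_invertible (S : H -> H) (d : R) : A S -> op_symmetric S -> 0 < d ->
  (forall x, d * rdot (1A x) x <= rdot (S x) x) ->
  exists2 W, A W & S \o W = 1A /\ W \o S = 1A.
Proof.
move=> AS sS d0 hS.
have C0 : 0 < opnorm S + d by rewrite ltr_wpDl// opnorm_ge0//; exact: cstar_bounded AS.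
pose C := opnorm S + d; pose T := 1A - (C^-1)%:C%C *: S.
have AT : A T by apply: cstar_sub; [exact: one_in|exact: cstar_scale].
have Tx x : T x = 1A x - (C^-1)%:C%C *: S x by [].
pose rho := 1 - d / C.
have dC : d / C <= 1 by rewrite ler_pdivrMr// mul1r lerDr opnorm_ge0//; exact: cstar_bounded AS.
have dC0 : 0 < d / C by rewrite divr_gt0.
have r0 : 0 <= rho by rewrite /rho; lra.
have r1 : rho < 1 by rewrite /rho; lra.
have sT : op_symmetric T.
  move=> x y; rewrite !Tx dotDl dotDr dotNl dotNr dotZl dotZr one_symmetric sS.
  by congr (_ - _ * _); apply/eqP; rewrite eq_complex/= oppr0 !eqxx.
have bT : opbound T rho.
  apply: symmetric_rnorm_le => //; first exact: cstar_lin AT.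
  move=> x; rewrite Tx rdotBl rdotZl.
  have h1 := hS x; have h2 := rdot_le_opnorm x AS; have h3 := rdot_one_le A x.
  have h4 : 0 <= rdot (1A x) x by exact/op_pos_rdot/one_pos.
  move: h1 h2 h3 h4; move: (rdot (1A x) x) (rdot (S x) x) => u v h1 h2 h3 h4.
  have Cv : d / C * u <= C^-1 * v by rewrite mulrAC mulrC ler_pM2l ?invr_gt0.
  have Cv2 : C^-1 * v <= u.
    rewrite mulrC ler_pdivrMr//; apply: le_trans h2 _.
    by rewrite mulrC ler_wpM2l// lerDl ltW.
  rewrite ger0_norm ?subr_ge0//.
  apply: (@le_trans _ _ (rho * u)); first by rewrite /rho mulrBl mul1r lerD2l lerN2.
  exact: ler_wpM2l.
have [W AW [W1 W2]] := neumann_invertible AT r0 r1 bT.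
have E : 1A - T = (C^-1)%:C%C *: S by rewrite /T opprB addrC subrK.
rewrite E in W1 W2.
exists ((C^-1)%:C%C *: W); first exact: cstar_scale.
have lS := cstar_lin AS.
split; apply/funext => x /=.
- by rewrite fctE linear_scale//; move/(congr1 (@^~ x)): W1.
- rewrite fctE; move/(congr1 (@^~ x)): W2 => /= <-; rewrite [in RHS]fctE.
  by rewrite linear_scale//; exact: cstar_lin AW.
Qed.

End Complete.

(** * Spectrum and positivity *)

Section Spectral.
Context {R : realType} {H : hilbertType R} (A : cstarAlgebra H).
Variables (X : H -> H) (AX : A X) (sX : op_symmetric X).
Local Notation "'1A'" := (cstar_one A).

(** Only vectors in the range of the identity of the algebra matter: the
    identity may be a proper projection. *)
Definition bounded_below (S : H -> H) :=
  exists2 d : R, 0 < d & forall x, 1A x = x -> d * rnorm x <= rnorm (S x).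

Lemma Im_dot_le (x y : H) : `|complex.Im (dot x y)| <= rnorm x * rnorm y.
Proof.
have E : complex.Im (dot x y) = rdot ((- 'i%C) *: x) y.
  rewrite /rdot dotZl; case: (dot x y) => a b /=; ring.
have n1 : rnorm ((- 'i%C) *: x) = rnorm x.
  rewrite /rnorm normrZ normrN normc_def/= expr0n expr1n/= add0r sqrtr1.
  by rewrite Re_realM mul1r.
have n2 : rnorm (('i%C) *: x) = rnorm x.
  by rewrite -n1 scaleNr rnormN.
rewrite ler_norml E; apply/andP; split; last by rewrite -n1 rdot_rnorm.
rewrite lerNl -rdotNl -scaleNr opprK -n2; exact: rdot_rnorm.
Qed.

Lemma bounded_below_nonreal (z : R[i]) : complex.Im z != 0 ->
  bounded_below (X - z *: 1A).
Proof.
move=> z0; exists `|complex.Im z|; first by rewrite normr_gt0.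
move=> x ex.
have [x0|x0] := eqVneq (rnorm x) 0; first by rewrite x0 mulr0 rnorm_ge0.
have xp : 0 < rnorm x by rewrite lt_def x0 rnorm_ge0.
rewrite -(ler_pM2r xp); apply: le_trans (Im_dot_le _ _).
have -> : (X - z *: 1A) x = X x - z *: x by rewrite !fctE ex.
rewrite dotDl dotNl dotZl Im_add (symmetric_Im _ sX) add0r Im_opp normrN.
rewrite -sqr_norm_dot rnormE -rmorphXn/=.
case: z z0 => a b /= _.
by rewrite mulr0 add0r normrM (ger0_norm (sqr_ge0 _)) expr2 mulrA.
Qed.

Lemma bounded_below_resolvent (z : R[i]) : ~ spectrum A X z ->
  bounded_below (X - z *: 1A).
Proof.
move=> /contrapT[Y AY [_ hY]].
have b0 := opnorm_ge0 (cstar_bounded AY).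
have c0 : 0 < opnorm Y + 1 by rewrite ltr_wpDl.
exists (opnorm Y + 1)^-1; first by rewrite invr_gt0.
move=> x ex; rewrite ler_pdivrMl//.
have -> : rnorm ((X - z *: 1A) x) = rnorm ((z *: 1A - X) x).
  by rewrite -rnormN !fctE opprB.
have /(congr1 (@^~ x)) /= E := hY.
rewrite -{1}ex -E; apply: le_trans (opnorm_bound (cstar_bounded AY) _) _.
by rewrite ler_wpM2r ?rnorm_ge0// lerDl.
Qed.

Lemma bounded_below_prod (s : seq R[i]) :
  (forall z, z \in s -> bounded_below (X - z *: 1A)) ->
  bounded_below (cpoly A X (\prod_(z <- s) ('X - z%:P))).
Proof.
elim: s => [|z s IH] hs.
  rewrite big_nil -polyC1 cpolyC//; exists 1 => // x ex.
  by rewrite mul1r scale1r ex.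
have [d d0 hd] := hs z (mem_head _ _).
have [d' d'0 hd'] : bounded_below (cpoly A X (\prod_(z <- s) ('X - z%:P))).
  by apply: IH => y ys; apply: hs; rewrite inE ys orbT.
rewrite big_cons cpolyM//; exists (d * d'); first exact: mulr_gt0.
move=> x ex /=; rewrite -mulrA.
apply: le_trans (ler_wpM2l (ltW d0) (hd' x ex)) _.
have -> : cpoly A X ('X - z%:P) = X - z *: 1A.
  rewrite cpolyD// -polyCN cpolyC// scaleNr; congr (_ - _).
  have := op_polyX AX; rewrite op_polyE map_polyX//.
apply: hd; exact/onel/cpoly_in.
Qed.

(** Where the form of a positive [P] is small, so is the norm of [P x], by the
    Cauchy-Schwarz inequality of its form. *)
Lemma not_bounded_below (P : H -> H) : A P -> op_pos P ->
  (forall d, 0 < d -> exists2 x, 1A x = x /\ rnorm x = 1 & rdot (P x) x < d) ->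
  ~ bounded_below P.
Proof.
move=> AP pP hP [d d0 hd].
have c0 : 0 < opnorm P + 1 by rewrite ltr_wpDl// opnorm_ge0//; exact: cstar_bounded AP.
have bP x : rnorm (P x) <= (opnorm P + 1) * rnorm x.
  apply: le_trans (opnorm_bound (cstar_bounded AP) _) _.
  by rewrite ler_wpM2r ?rnorm_ge0// lerDl.
have [|x [ex x1]] := hP (d ^+ 2 / (opnorm P + 1)).
  by rewrite divr_gt0// exprn_gt0.
rewrite ltr_pdivlMr// mulrC ltNge => /negP; apply.
apply: le_trans (op_pos_rnorm_sqr (cstar_lin AP) pP c0 bP x).
have := hd x ex; rewrite x1 mulr1 => h.
by rewrite ler_sqr ?nnegrE ?rnorm_ge0// ltW.
Qed.

(** Let [m] be the infimum of the form of [f(X)] on unit vectors. Then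
    [f(X) - m] is positive and not bounded below. Splitting [f - m] into linear
    factors over the complex numbers, one factor [X - z] is not bounded below
    either; as [X] is symmetric, [z] is real, and it lies in the spectrum. *)
Lemma spectrum_infimum (f : {poly R}) : (1 < size f)%N ->
  (exists x, 1A x <> 0) ->
  exists2 t : R, spectrum A X t%:C%C &
    forall x, f.[t] * rdot (1A x) x <= rdot (op_poly A X f x) x.
Proof.
move=> sf [x0 ex0].
pose q := op_poly A X f.
have Aq : A q by exact: op_poly_in.
have lq := cstar_lin Aq.
have unit x : 1A x <> 0 -> exists y, [/\ 1A y = y, rnorm y = 1 &
    forall Y, A Y -> rdot (Y x) x = rnorm (1A x) ^+ 2 * rdot (Y y) y].
  move=> ex; have xp : 0 < rnorm (1A x).
    by rewrite lt_def rnorm_ge0 andbT; apply/eqP => /rnorm_eq0.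
  exists ((rnorm (1A x))^-1%:C%C *: 1A x); split.
  - by rewrite linear_scale ?onee//; exact: one_lin.
  - by rewrite rnormZ ger0_norm ?invr_ge0 ?ltW// mulVf// gt_eqF.
  - move=> Y AY; rewrite (linear_scale _ _ (cstar_lin AY)) rdotZl rdotZr -(rdot_corner x AY).
    by field; rewrite gt_eqF.
pose E := [set rdot (q y) y | y in [set y | 1A y = y /\ rnorm y = 1]].
have E0 : E !=set0.
  by have [y [ey y1 _]] := unit _ ex0; exists (rdot (q y) y); exists y.
have lE : has_inf E.
  split => //; exists (- opnorm q) => _ [y [ey y1] <-].
  have := rdot_rnorm (q y) (- y).
  rewrite rnormN rdotNr y1 mulr1.
  have := opnorm_bound (cstar_bounded Aq) y; rewrite y1 mulr1; lra.
pose m := inf E.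
have hm x : m * rdot (1A x) x <= rdot (q x) x.
  have [ex|ex] := pselect (1A x = 0).
    by rewrite ex rdot0l mulr0 (rdot_corner x Aq) ex rdot0r.
  have [y [ey y1 hy]] := unit _ ex.
  rewrite (hy _ Aq) rdot_one mulrC ler_wpM2l ?sqr_ge0//.
  by apply: ge_inf; [case: lE|exists y].
pose g := f - m%:P.
have g0 : g != 0.
  apply/negP => /eqP /subr0_eq h; move: sf; rewrite h size_polyC.
  by case: eqP.
pose P := op_poly A X g.
have AP : A P by exact: op_poly_in.
have Px x : rdot (P x) x = rdot (q x) x - m * rdot (1A x) x.
  by rewrite /P /g op_polyB// op_polyC// rdotBl rdotZl.
have pP : op_pos P.
  apply: symmetric_pos; first exact: op_poly_symmetric.
  by move=> x; rewrite Px subr_ge0.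
have nP : ~ bounded_below P.
  apply: not_bounded_below => // d d0.
  have [_ [y [ey y1] <-] hy] := inf_adherent d0 lE.
  exists y => //; rewrite Px rdot_one ey y1 expr1n mulr1.
  by rewrite ltrBlDl.
have [s hs] := closed_field_poly_normal (map_poly (real_complex R) g).
set l := lead_coef _ in hs.
have l0 : l != 0 by rewrite lead_coef_eq0 map_poly_eq0.
have [z zs hz] : exists2 z, z \in s & ~ bounded_below (X - z *: 1A).
  apply/not_exists2P => h; apply: nP.
  have [|d d0 hd] := @bounded_below_prod s.
    by move=> z zs; have [|/contrapT] := h z.
  rewrite /P op_polyE hs cpolyZ.
  exists (complex.Re `|l| * d).
    rewrite mulr_gt0//; have : 0 < `|l| by rewrite normr_gt0.
    by rewrite ltcE => /andP[].
  move=> x ex; have := hd x ex.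
  rewrite [(l *: _) x]/(l *: _ x) -mulrA => h1.
  have -> (y : H) : rnorm (l *: y) = complex.Re `|l| * rnorm y.
    by rewrite /rnorm normrZ [`|y|]rnormE normc_def/= mul0r subr0.
  rewrite ler_wpM2l//.
  by have := normr_ge0 l; rewrite lecE => /andP[].
have zr : complex.Im z = 0.
  by apply/eqP/negP => /negP /bounded_below_nonreal.
have zE : z = (complex.Re z)%:C%C by case: (z) zr => a b /= ->.
have spz : spectrum A X z by apply: contrapT => /bounded_below_resolvent.
have gz : g.[complex.Re z] = 0.
  have : root (map_poly (real_complex R) g) z.
    by rewrite hs rootZ// root_prod_XsubC.
  by rewrite zE fmorph_root => /rootP.
exists (complex.Re z); first by rewrite -zE.
move=> x; have <- : m = f.[complex.Re z]; last exact: hm.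
by move: gz; rewrite /g hornerD hornerN hornerC => /subr0_eq ->.
Qed.

(** [spectrum_infimum] bounds the form below by a value of [f] on the spectrum.
    A constant [f] takes its value there because the spectrum is not empty, by
    [spectrum_infimum] for ['X]. *)
Lemma op_poly_pos (f : {poly R}) :
  (forall t : R, spectrum A X t%:C%C -> 0 <= f.[t]) -> op_pos (op_poly A X f).
Proof.
move=> hf; apply: symmetric_pos; first exact: op_poly_symmetric.
have [ex|] := pselect (forall x, 1A x = 0).
  by move=> x; rewrite (rdot_corner x (op_poly_in AX f)) ex rdot0r.
move=> /existsNP ex x.
have [t [st ht]] : exists t : R, spectrum A X t%:C%C /\
    f.[t] * rdot (1A x) x <= rdot (op_poly A X f x) x.
  have [sf|sf] := ltnP 1 (size f).
    by have [t st ht] := spectrum_infimum sf ex; exists t.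
  have [|t st _] := @spectrum_infimum 'X _ ex; first by rewrite size_polyX.
  exists t; split => //; rewrite (size1_polyC sf) hornerC op_polyC//.
  by rewrite rdotZl.
apply: le_trans ht; rewrite mulr_ge0 ?hf//.
exact/op_pos_rdot/one_pos.
Qed.

Lemma spectrum_itv (N t : R) : op_pos X ->
  (forall x, rdot (X x) x <= N * rdot (1A x) x) ->
  spectrum A X t%:C%C -> 0 <= t <= N.
Proof.
move=> pX XN st; have one0 x := op_pos_rdot x (one_pos A).
have sym (u v : R) : op_symmetric (u%:C%C *: 1A + v%:C%C *: X).
  move=> x y; rewrite ![(_ + _) _]/(_ *: _ + _ *: _) dotDl dotDr !dotZl !dotZr.
  rewrite one_symmetric sX.
  by congr (_ * _ + _ * _); apply/eqP; rewrite eq_complex/= oppr0 !eqxx.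
have Nx (Y : H -> H) y : (- Y) y = - Y y by [].
have Ain (u v : R) : A (u%:C%C *: 1A + v%:C%C *: X).
  by apply: cstar_add; apply: cstar_scale => //; exact: one_in.
rewrite !leNgt; apply/andP; split; apply/negP => ht; apply: st.
- have [||W AW [W1 W2]] := @strictly_pos_invertible _ _ A _ (- t) (Ain (- t) 1) (sym (- t) 1).
  + by rewrite oppr_gt0.
  + move=> x; by rewrite rdotDl !rdotZl mul1r lerDl op_pos_rdot.
  have E : t%:C%C *: 1A - X = - ((- t)%:C%C *: 1A + 1%:C%C *: X).
    by rewrite scale1r opprD rmorphN scaleNr opprK.
  exists (- W); first by rewrite -scaleN1r; exact: cstar_scale.
  rewrite E; split; apply/funext => x /=.
  + rewrite !Nx (linear_opp _ (cstar_lin (Ain _ _))) opprK.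
    by move/(congr1 (@^~ x)): W1.
  + rewrite !Nx (linear_opp _ (cstar_lin AW)) opprK.
    by move/(congr1 (@^~ x)): W2.
- have [||W AW [W1 W2]] := @strictly_pos_invertible _ _ A _ (t - N) (Ain t (-1)) (sym t (-1)).
  + by rewrite subr_gt0.
  + move=> x; by rewrite rdotDl !rdotZl; have := XN x; lra.
  have E : t%:C%C *: 1A - X = (t)%:C%C *: 1A + (-1)%:C%C *: X.
    by rewrite rmorphN rmorph1 scaleN1r.
  by exists W => //; rewrite E.
Qed.

End Spectral.

(** * Functional calculus of a positive element *)

Section Calculus.
Context {R : realType} {H : hilbertType R} (A : cstarAlgebra H).
Variables (X : H -> H) (AX : A X) (pX : op_pos X).
Local Notation "'1A'" := (cstar_one A).

Let sX : op_symmetric X. Proof. exact: op_pos_symmetric (cstar_lin AX) pX. Qed.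

Lemma op_poly_opbound (p : {poly R}) (c : R) :
  (forall t : R, spectrum A X t%:C%C -> `|p.[t]| <= c) -> 0 <= c ->
  opbound (op_poly A X p) c.
Proof.
move=> hp c0; apply: symmetric_rnorm_le => //.
- exact/cstar_lin/op_poly_in.
- exact: op_poly_symmetric.
move=> x; apply: (@le_trans _ _ (c * rdot (1A x) x)); last first.
  by rewrite ler_wpM2l// rdot_one_le.
rewrite ler_norml; apply/andP; split.
- have := @op_poly_pos _ _ A X AX sX (c%:P + p).
  rewrite op_polyD// op_polyC// => h.
  have {h} /(op_pos_rdot x) : op_pos (c%:C%C *: 1A + op_poly A X p).
    apply: h => t st; rewrite hornerD hornerC.
    by have := hp t st; rewrite ler_norml => /andP[]; lra.
  rewrite rdotDl rdotZl; lra.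
- have := @op_poly_pos _ _ A X AX sX (c%:P - p).
  rewrite op_polyB// op_polyC// => h.
  have {h} /(op_pos_rdot x) : op_pos (c%:C%C *: 1A - op_poly A X p).
    apply: h => t st; rewrite hornerD hornerN hornerC.
    by have := hp t st; rewrite ler_norml => /andP[]; lra.
  rewrite rdotBl rdotZl; lra.
Qed.

Lemma cfc_approx (f : R -> R) Y (e : R) : is_cfc A f X Y -> 0 < e ->
  exists p : {poly R},
    (forall t : R, spectrum A X t%:C%C -> `|p.[t] - f t| <= e) /\
    opbound (op_poly A X p - Y) e.
Proof.
move=> [AY [p [hp hY]]] e0.
have [N1 _ h1] := hp _ e0.
have /cvgrPdist_le/(_ _ e0)[N2 _ h2] := hY.
exists (p (maxn N1 N2)); split.
  by move=> t st; apply: ltW; apply: h1 => //=; exact: leq_maxl.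
move=> x; have := h2 _ (leq_maxr N1 N2).
rewrite /= sub0r normrN => h3.
have Ad : A (op_poly A X (p (maxn N1 N2)) - Y).
  by apply: cstar_sub => //; exact: op_poly_in.
apply: le_trans (opnorm_bound (cstar_bounded Ad) x) _.
by rewrite ler_wpM2r ?rnorm_ge0//; apply: le_trans h3; exact: ler_norm.
Qed.

Lemma cfc_Im (f : R -> R) Y x : is_cfc A f X Y -> complex.Im (dot (Y x) x) = 0.
Proof.
move=> hY; apply/eqP; rewrite -normr_eq0 eq_le normr_ge0 andbT.
apply: (@le0_of_small _ _ (rnorm x ^+ 2)) => [|e e0]; first exact: sqr_ge0.
have [p [_ hp]] := cfc_approx hY e0.
have -> : complex.Im (dot (Y x) x) = - complex.Im (dot ((op_poly A X p - Y) x) x).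
  rewrite [(_ - Y) x]/(_ x - Y x) dotDl dotNl Im_add Im_opp.
  by rewrite (symmetric_Im _ (op_poly_symmetric AX _ sX)) add0r opprK.
rewrite normrN; apply: le_trans (Im_dot_le _ _) _.
by rewrite expr2 mulrA ler_wpM2r ?rnorm_ge0.
Qed.

(** With [cfc_ge], determines the form of every [Y] accepted by [is_cfc] from
    the values of [f] on the spectrum: polynomials close to [f] there have
    close values at [X], by [op_poly_pos]. *)
Lemma cfc_le (f : R -> R) Y (q : {poly R}) : is_cfc A f X Y ->
  (forall t : R, spectrum A X t%:C%C -> f t <= q.[t]) ->
  forall x, rdot (Y x) x <= rdot (op_poly A X q x) x.
Proof.
move=> hY hq x; rewrite -subr_le0.
apply: (@le0_of_small _ _ (2 * rnorm x ^+ 2)) => [|e e0].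
  by rewrite mulr_ge0 ?sqr_ge0.
have [p [h1 h2]] := cfc_approx hY e0.
have := @op_poly_pos _ _ A X AX sX (q - p + e%:P).
rewrite op_polyD// op_polyB// op_polyC// => h.
have {h} /(op_pos_rdot x) : op_pos (op_poly A X q - op_poly A X p + e%:C%C *: 1A).
  apply: h => t st; rewrite !hornerD hornerN hornerC.
  by have := h1 t st; have := hq t st; rewrite ler_norml => ? /andP[]; lra.
rewrite rdotDl rdotBl rdotZl.
have := rdot_rnorm (- ((op_poly A X p - Y) x)) x.
rewrite rdotNl rnormN [X in rdot X]/(_ x - Y x) rdotBl.
have := ler_wpM2r (rnorm_ge0 x) (h2 x); rewrite -[e * _ * _]mulrA -expr2.
have := ler_wpM2l (ltW e0) (rdot_one_le A x).
lra.
Qed.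

Lemma is_cfc_opp (f : R -> R) Y : is_cfc A f X Y ->
  is_cfc A (fun t => - f t) X (- Y).
Proof.
move=> [AY [p [hp hY]]]; split.
  by rewrite -scaleN1r; exact: cstar_scale.
exists (fun n => - p n); split.
  move=> e /hp [n0 _ h]; exists n0 => // n n0n t st.
  by rewrite hornerN -opprD normrN; exact: h.
have opnormN Z : opnorm (- Z) = opnorm (Z : H -> H).
  by rewrite /opnorm; congr sup; apply: eq_imagel => x _; rewrite [(- Z) x]/(- Z x) normrN.
by under eq_fun do rewrite op_polyN// -opprD opnormN.
Qed.

Lemma cfc_ge (f : R -> R) Y (q : {poly R}) : is_cfc A f X Y ->
  (forall t : R, spectrum A X t%:C%C -> q.[t] <= f t) ->
  forall x, rdot (op_poly A X q x) x <= rdot (Y x) x.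
Proof.
move=> /is_cfc_opp hY hq x; rewrite -lerN2 -!rdotNl.
have := cfc_le (q := - q) hY _ x; rewrite op_polyN//; apply => t st.
by rewrite hornerN lerN2 hq.
Qed.

Lemma spectrum_opnorm (t : R) : spectrum A X t%:C%C -> 0 <= t <= opnorm X.
Proof. by apply: spectrum_itv => // x; exact: rdot_le_opnorm. Qed.

(** The Bernstein polynomials of [f] at [X] form a Cauchy sequence. *)
Lemma cfc_exists (f : R -> R) (N L : R) : opnorm X <= N -> 0 < N ->
  (forall x y, 0 <= x <= N -> 0 <= y <= N -> `|f x - f y| <= L * `|x - y|) ->
  exists Y, is_cfc A f X Y.
Proof.
move=> XN N0 fL.
have sp t : spectrum A X t%:C%C -> 0 <= t <= N.
  by move=> /spectrum_opnorm /andP[-> h]; apply: le_trans XN.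
have conv := bernstein_cvg N0 fL.
pose Z n := op_poly A X (bernstein N f n).
have AZ n : A (Z n) by exact: op_poly_in.
have [|Y AY hY] := cstar_complete AZ.
  move=> e e0; have e2 : 0 < e / 2 by rewrite divr_gt0.
  have [n0 hn] := conv _ e2; exists n0.+1 => n d n0n.
  rewrite /Z -op_polyB//; apply: op_poly_opbound; last exact: ltW.
  move=> t /sp tN; rewrite hornerD hornerN.
  have h1 := hn n n0n t tN; have h2 := hn (n + d)%N (leq_trans n0n (leq_addr _ _)) t tN.
  move: h1 h2; rewrite !ler_norml => /andP[? ?] /andP[? ?]; lra.
exists Y; split => //; exists (bernstein N f); split.
  move=> e e0; have e2 : 0 < e / 2 by rewrite divr_gt0.
  have [n0 hn] := conv _ e2; exists n0.+1 => // n /= n0n t /sp tN.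
  by apply: le_lt_trans (hn n n0n t tN) _; rewrite ltr_pdivrMr// mulr_natr mulr2n ltrDr.
apply/cvgrPdist_le => e e0; have [n0 hn] := hY e e0; exists n0 => // n /= n0n.
have Ad : A (Z n - Y) by exact: cstar_sub.
rewrite sub0r normrN ger0_norm ?opnorm_ge0//; last exact: cstar_bounded Ad.
by apply: opnorm_le; [exact: hn|exact: ltW].
Qed.

Lemma op_powR_cfc (r : R) : 1 < r -> r <= 2 ->
  is_cfc A (fun x => x `^ r) X (op_powR A X r).
Proof.
move=> r1 r2.
have N0 : 0 < opnorm X + 1 by rewrite ltr_wpDl// opnorm_ge0//; exact: cstar_bounded AX.
have [|Y hY] := cfc_exists _ N0 (powR_lipschitz N0 r1 r2).
  by rewrite lerDl.
exact: (xgetPex 0 (ex_intro _ Y hY)).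
Qed.

End Calculus.

(** * Pointwise inequality and variational formula *)

Section PositiveMap.
Context {R : realType} {H K : hilbertType R}.
Variables (A : cstarAlgebra H) (B : cstarAlgebra K).
Variables (phi : (H -> H) -> K -> K) (phiP : positive_map A B phi).

Lemma positive_map_in X : A X -> B (phi X).
Proof. by case: phiP => h _ _; exact: h. Qed.
Lemma positive_map_pos X : A X -> op_pos X -> op_pos (phi X).
Proof. by case: phiP => _ _ h; exact: h. Qed.
Lemma positive_mapD X Y : A X -> A Y -> phi (X + Y) = phi X + phi Y.
Proof. by case: phiP => _ h _ aX aY; rewrite -{1}(scale1r X) h// scale1r. Qed.
Lemma positive_map0 : phi 0 = 0.
Proof.
have := positive_mapD (cstar_zero A) (cstar_zero A).
by rewrite addr0 -{1}[phi 0]addr0 => /addrI.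
Qed.
Lemma positive_mapZ c X : A X -> phi (c *: X) = c *: phi X.
Proof.
case: phiP => _ h _ aX; rewrite -(addr0 (c *: X)) h ?positive_map0 ?addr0//.
exact: cstar_zero.
Qed.
Lemma positive_map_sum I (s : seq I) (F : I -> H -> H) : (forall i, A (F i)) ->
  phi (\sum_(i <- s) F i) = \sum_(i <- s) phi (F i).
Proof.
move=> hF; elim: s => [|i s IH]; first by rewrite !big_nil positive_map0.
by rewrite !big_cons positive_mapD ?IH//; exact: cstar_sum.
Qed.

Lemma rdot_suml I (s : seq I) (F : I -> K -> K) x y :
  rdot ((\sum_(i <- s) F i) x) y = \sum_(i <- s) rdot (F i x) y.
Proof.
elim: s => [|i s IH]; first by rewrite !big_nil; exact: rdot0l.
by rewrite !big_cons -IH -rdotDl.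
Qed.

(** A finite sum of operator convex functions [x ^ 2 / (al * x + be)] below
    [x ^ r], as provided by [powR_quadratic_fractions]. *)
Definition lower_fractions (r : R) (s : seq (R * R)) :=
  (forall i, i \in s -> 0 <= i.1 /\ 0 < i.2) /\
  forall x, 0 <= x -> \sum_(i <- s) x ^+ 2 / (i.1 * x + i.2) <= x `^ r.

Lemma lower_fractions_scale (r w x : R) (s : seq (R * R)) : lower_fractions r s ->
  0 < w -> 0 <= x ->
  \sum_(i <- s) x ^+ 2 / (i.1 * x + w * i.2) <= w `^ (1 - r) * x `^ r.
Proof.
move=> [s1 s2] w0 x0.
have -> : w `^ (1 - r) * x `^ r = w * (x / w) `^ r.
  rewrite -{1}(divfK (lt0r_neq0 w0) x) (@powRM _ (x / w) w) ?divr_ge0 ?(ltW w0)//.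
  have E : w `^ (1 - r) * w `^ r = w.
    rewrite -powRD ?subrK ?powRr1 ?(ltW w0)//.
    by apply/implyP => _; rewrite gt_eqF.
  by rewrite mulrCA E mulrC.
apply: (@le_trans _ _ (w * \sum_(i <- s) (x / w) ^+ 2 / (i.1 * (x / w) + i.2))).
  rewrite mulr_sumr le_eqVlt; apply/orP; left; apply/eqP.
  apply: eq_big_seq => i /s1[i1 i2]; field.
  by rewrite !gt_eqF// ?ltr_wpDl ?mulr_ge0 ?mulr_gt0.
by rewrite ler_pM2l// s2// divr_ge0// ltW.
Qed.

(** The pointwise inequality behind Jensen's inequality. The elements [b_k(X)]
    of the commutative algebra generated by [X], [b_k] the Bernstein basis,
    are positive, so that it is enough to prove the inequality at the nodes,
    where it is the inequality between scalar quadratic forms. *)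
Lemma positive_map_powR (r w : R) (s : seq (R * R)) (X : H -> H)
    (xi : K) (eta : R * R -> K) :
  1 < r -> r <= 2 -> lower_fractions r s -> 0 < w -> A X -> op_pos X ->
  \sum_(i <- s) (2 * rdot (phi X xi) (eta i)
     - (i.1 * rdot (phi X (eta i)) (eta i)
     + i.2 * (w * rdot (phi (cstar_one A) (eta i)) (eta i))))
  <= w `^ (1 - r) * rdot (phi (op_powR A X r) xi) xi.
Proof.
move=> r1 r2 hs w0 AX pX.
have hY := op_powR_cfc AX pX r1 r2; set Y := op_powR A X r in hY *.
have AY : A Y by case: hY.
set a := w `^ (1 - r).
have a0 : 0 <= a by exact: powR_ge0.
have AI : A (cstar_one A) by exact: one_in.
have pI : op_pos (phi (cstar_one A)) by exact/positive_map_pos/one_pos.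
rewrite -subr_le0.
apply: (@le0_of_small _ _ (a * rdot (phi (cstar_one A) xi) xi)) => [|d d0].
  by rewrite mulr_ge0// op_pos_rdot.
rewrite lerBlDl.
pose N := opnorm X + 1.
have N0 : 0 < N by rewrite ltr_wpDl// opnorm_ge0//; exact: cstar_bounded AX.
have sp t : spectrum A X t%:C%C -> 0 <= t <= N.
  by move=> /(spectrum_opnorm AX pX) /andP[-> h]; apply: le_trans h _; rewrite lerDl.
have [n0 hn0] := bernstein_cvg N0 (powR_lipschitz N0 r1 r2) d0.
pose n := n0.+1; have {hn0} hn := hn0 n (ltnSn _).
(* Positive operators with sum [phi 1]; [phi X] is their mean at the nodes. *)
pose P (k : 'I_n.+1) := phi (op_poly A X (bern_basis N n k)).
have sX := op_pos_symmetric (cstar_lin AX) pX.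
have BP k : B (P k) by exact/positive_map_in/op_poly_in.
have lP k : linear (P k) := cstar_lin (BP k).
have pP k : op_pos (P k).
  apply: positive_map_pos; first exact: op_poly_in.
  by apply: op_poly_pos => // t /sp tN; exact: bern_basis_ge0.
have sP k := op_pos_symmetric (lP k) (pP k).
have sumP (c : 'I_n.+1 -> R) (u v : K) :
    rdot (phi (op_poly A X (\sum_k c k *: bern_basis N n k)) u) v =
    \sum_k c k * rdot (P k u) v.
  rewrite op_poly_sum// positive_map_sum; last by move=> k; exact: op_poly_in.
  rewrite rdot_suml; apply: eq_bigr => k _.
  by rewrite op_polyZ// positive_mapZ ?rdotZl//; exact: op_poly_in.
have sum1 u v : rdot (phi (cstar_one A) u) v = \sum_k rdot (P k u) v.
  have := sumP (fun=> 1) u v.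
  under eq_bigr do rewrite scale1r.
  rewrite bern_basis_sum// -polyC1 op_polyC// scale1r => ->.
  by apply: eq_bigr => k _; rewrite mul1r.
have sumX u v : rdot (phi X u) v = \sum_(k < n.+1) node N n k * rdot (P k u) v.
  by rewrite -(sumP (fun k => node N n k)) bern_basis_node// op_polyX.
have upper : a * \sum_(k < n.+1) (node N n k) `^ r * rdot (P k xi) xi <=
    a * rdot (phi Y xi) xi + d * (a * rdot (phi (cstar_one A) xi) xi).
  rewrite -(sumP (fun k => node N n k `^ r)) -(bernsteinE N (fun x => x `^ r)).
  set b := bernstein _ _ _ in hn *.
  have pD : op_pos (Y + d%:C%C *: cstar_one A - op_poly A X b).
    apply/op_posP => x.
    have E : (Y + d%:C%C *: cstar_one A - op_poly A X b) x =
      Y x + d%:C%C *: cstar_one A x - op_poly A X b x by [].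
    split.
      rewrite E !dotDl dotNl dotZl !Im_add Im_opp Im_realM (cfc_Im AX pX x hY).
      by rewrite (symmetric_Im _ (one_symmetric A)) (symmetric_Im _ (op_poly_symmetric AX _ sX)) !(mulr0, oppr0, addr0).
    rewrite E rdotBl rdotDl rdotZl subr_ge0.
    have := @cfc_ge _ _ A X AX pX _ _ (b - d%:P) hY.
    rewrite op_polyB// op_polyC// => /(_ _ x); rewrite [(_ - _) x]/(_ x - _ x) rdotBl.
    rewrite rdotZl lerBlDr; apply.
    move=> t /sp tN; rewrite hornerD hornerN hornerC lerBlDr.
    by have := hn t tN; rewrite ler_norml => /andP[_]; lra.
  have AdI : A (d%:C%C *: cstar_one A) by exact: cstar_scale.
  have Ab : A (op_poly A X b) by exact: op_poly_in.
  have := op_pos_rdot xi (positive_map_pos (cstar_sub (cstar_add AY AdI) Ab) pD).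
  rewrite -scaleN1r positive_mapD ?positive_mapD ?positive_mapZ//.
  2: exact: cstar_add.
  2: exact: cstar_scale.
  rewrite scaleN1r [(_ - _) xi]/(_ xi + _ xi - _ xi) rdotBl rdotDl rdotZl subr_ge0 => h.
  apply: le_trans (ler_wpM2l a0 h) _; by rewrite mulrDr lerD2l mulrCA.
apply: le_trans upper.
under eq_bigr do rewrite sum1 !sumX.
(* [2 x v - g z <= x ^ 2 / g * u] is the positivity of the form of [P k] at
   [x xi - g eta], for each fraction, with [g] its denominator. *)
have pointwise (k : 'I_n.+1) :
    \sum_(i <- s) (2 * (node N n k * rdot (P k xi) (eta i)) -
      (i.1 * (node N n k * rdot (P k (eta i)) (eta i)) +
       i.2 * (w * rdot (P k (eta i)) (eta i)))) <=
    a * (node N n k `^ r * rdot (P k xi) xi).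
  have /andP[x0 _] : 0 <= node N n k <= N by apply: node_itv => //; rewrite -ltnS.
  move: (node N n k) x0 => x x0.
  have p0 : 0 <= rdot (P k xi) xi by exact: op_pos_rdot.
  rewrite mulrA; apply: le_trans (ler_wpM2r p0 (lower_fractions_scale hs w0 x0)).
  rewrite mulr_suml big_seq [leRHS]big_seq; apply: ler_sum => i /(proj1 hs)[i1 i2].
  set g := i.1 * x + w * i.2.
  have g0 : 0 < g by rewrite ltr_wpDl ?mulr_ge0 ?mulr_gt0.
  have := op_pos_rdot (x%:C%C *: xi - g%:C%C *: eta i) (pP k).
  rewrite (linear_sub _ _ (lP k)) !(linear_scale _ _ (lP k)) !rdotBl !rdotBr !rdotZl !rdotZr.
  rewrite (symmetric_rdot (eta i) xi (sP k)) (rdotC (eta i)).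
  move: (rdot (P k xi) xi) (rdot (P k xi) (eta i)) (rdot (P k (eta i)) (eta i)).
  move=> u v z h; rewrite mulrAC ler_pdivlMr//.
  have -> : 2 * (x * v) - (i.1 * (x * z) + i.2 * (w * z)) = 2 * (x * v) - g * z.
    by rewrite /g; ring.
  by rewrite -subr_ge0; apply: le_trans h _; rewrite le_eqVlt; apply/orP; left; apply/eqP; ring.
rewrite mulr_sumr; apply: le_trans (ler_sum _ (fun k _ => pointwise k)).
rewrite exchange_big/= le_eqVlt; apply/orP; left; apply/eqP.
apply: eq_bigr => i _.
by rewrite !mulr_sumr -big_split/= -sumrB.
Qed.

End PositiveMap.

(** For each fraction [x ^ 2 / g], with [g] affine, the maximum over [eta] of
    [2 Re <V xi, eta> - <g(V) eta, eta>] is [<V g(V)^-1 V xi, xi>], attained at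
    [eta = g(V)^-1 V xi]. A polynomial [h] close to [x / g] gives [eta = h(V) xi]
    without inverting operators, since
    [2 x h - g h ^ 2 = x ^ 2 / g - g (h - x / g) ^ 2]. The factor [c] rescales
    [V] to [V / c]. *)
Lemma powR_variational {R : realType} {K : hilbertType R} (B : cstarAlgebra K)
    (r c e : R) (V : K -> K) (xi : K) :
  1 < r -> r <= 2 -> 0 < c -> 0 < e -> B V -> op_pos V ->
  exists s (eta : R * R -> K), lower_fractions r s /\
  rdot (op_powR B V r xi) xi <= c `^ (r - 1) *
   (\sum_(i <- s) (2 * rdot (V xi) (eta i)
     - (i.1 * rdot (V (eta i)) (eta i)
     + i.2 * (c * rdot (cstar_one B (eta i)) (eta i)))) + e).
Proof.
move=> r1 r2 c0 e0 BV pV.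
have hW := op_powR_cfc BV pV r1 r2; set W := op_powR B V r in hW *.
pose N := opnorm V + 1.
have N0 : 0 < N by rewrite ltr_wpDl// opnorm_ge0//; exact: cstar_bounded BV.
have sV := op_pos_symmetric (cstar_lin BV) pV.
have sp t : spectrum B V t%:C%C -> 0 <= t <= N.
  by move=> /(spectrum_opnorm BV pV) /andP[-> h]; apply: le_trans h _; rewrite lerDl.
have D0 : 0 < rnorm xi ^+ 2 + 1 by rewrite ltr_wpDl ?sqr_ge0.
pose k := e / 2 / (rnorm xi ^+ 2 + 1).
have k0 : 0 < k by rewrite !divr_gt0.
have kc0 : 0 < k / c by rewrite divr_gt0.
have [s [s1 s2 s3]] := powR_quadratic_fractions (N / c) r1 r2 kc0.
pose g (i : R * R) x := i.1 * x + c * i.2.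
pose G := \sum_(i <- s) g i N.
have g_gt0 i x : i \in s -> 0 <= x -> 0 < g i x.
  by move=> /s1[i1 i2] x0; rewrite ltr_wpDl ?mulr_ge0 ?mulr_gt0.
have G0 : 0 <= G.
  by rewrite /G big_seq sumr_ge0// => i /g_gt0 h; rewrite ltW// h// ltW.
pose d := Num.min 1 (k / (G + 1)).
have G1 : 0 < G + 1 by rewrite ltr_wpDl.
have d0 : 0 < d by rewrite lt_min ltr01 divr_gt0.
have dG : d ^+ 2 * G <= k.
  have h1 : d <= 1 by rewrite ge_min lexx.
  have h2 : d <= k / (G + 1) by rewrite ge_min lexx orbT.
  apply: (@le_trans _ _ (d * (G + 1))).
    rewrite expr2 -mulrA ler_pM2l//; apply: (@le_trans _ _ (1 * G)).
      exact: ler_wpM2r.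
    by rewrite mul1r lerDl.
  by rewrite -ler_pdivlMr.
have /choice[h hh] : forall i, exists p : {poly R}, i \in s ->
    forall x, 0 <= x <= N -> `|p.[x] - x / g i x| <= d.
  move=> i; have [is_|] := boolP (i \in s); last by exists 0.
  have [i1 i2] := s1 _ is_.
  have [n0 hn] := bernstein_cvg N0 (fraction_lipschitz (N := N) i1 (mulr_gt0 c0 i2)) d0.
  by exists (bernstein N (fun x => x / g i x) n0.+1) => _; exact: hn.
pose eta i := op_poly B V (h i) xi.
exists s, eta; split; first by split.
pose gp (i : R * R) : {poly R} := i.1 *: 'X + (c * i.2)%:P.
pose Q := \sum_(i <- s) (2 *: ('X * h i) - h i * (gp i * h i)).
have BI := one_in B.
have QE : rdot (op_poly B V Q xi) xi = \sum_(i <- s) (2 * rdot (V xi) (eta i)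
     - (i.1 * rdot (V (eta i)) (eta i)
     + i.2 * (c * rdot (cstar_one B (eta i)) (eta i)))).
  rewrite op_poly_sum// rdot_suml; apply: eq_bigr => i _.
  rewrite op_polyB// op_polyZ// !op_polyM// op_polyX// op_polyD// op_polyZ// op_polyX// op_polyC//.
  set hp := op_poly B V (h i).
  have -> : (2%:C%C *: (V \o hp) - (hp \o ((i.1%:C%C *: V + (c * i.2)%:C%C *: cstar_one B) \o hp))) xi
     = 2%:C%C *: V (eta i) - hp (i.1%:C%C *: V (eta i) + (c * i.2)%:C%C *: cstar_one B (eta i)) by [].
  rewrite rdotBl rdotZl (symmetric_rdot _ _ sV) (rdotC _ (V xi)); congr (_ - _).
  rewrite (symmetric_rdot _ _ (op_poly_symmetric BV _ sV)) rdotDl !rdotZl -/(eta i).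
  by congr (_ + _); ring.
have Qlow x : 0 <= x <= N -> x `^ r <= c `^ (r - 1) * (Q.[x] + 2 * k).
  move=> /andP[x0 xN].
  have xc0 : 0 <= x / c by rewrite divr_ge0// ltW.
  have := s3 (x / c); rewrite xc0 ler_pM2r ?invr_gt0// xN => /(_ isT) h1.
  have -> : x `^ r = c `^ (r - 1) * (c * (x / c) `^ r).
    rewrite -{1}(divfK (lt0r_neq0 c0) x) (@powRM _ (x / c) c) ?divr_ge0 ?(ltW c0)//.
    have E : c `^ (r - 1) * c = c `^ r.
      rewrite -{2}(powRr1 (ltW c0)) -powRD ?subrK//.
      by apply/implyP => _; rewrite gt_eqF.
    by rewrite -E mulrC mulrA.
  rewrite ler_pM2l ?powR_gt0//.
  apply: (@le_trans _ _ (\sum_(i <- s) x ^+ 2 / g i x + k)).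
    apply: le_trans (ler_wpM2l (ltW c0) h1) _.
    rewrite mulrDr [c * (k / c)]mulrC divfK ?gt_eqF// lerD2r mulr_sumr.
    rewrite le_eqVlt; apply/orP; left; apply/eqP.
    apply: eq_big_seq => i is_; have := g_gt0 i x is_ x0; have [i1 i2] := s1 i is_.
    rewrite /g => h0; field; rewrite !gt_eqF// -[i.2 * c]mulrC //.
  have -> : Q.[x] = \sum_(i <- s) (x ^+ 2 / g i x - g i x * ((h i).[x] - x / g i x) ^+ 2).
    rewrite /Q horner_sum; apply: eq_big_seq => i is_.
    have gpE : (gp i).[x] = g i x by rewrite /gp !hornerE.
    rewrite hornerD hornerN hornerZ !hornerM hornerX gpE.
    have := g_gt0 i x is_ x0; move: (g i x) ((h i).[x]) => y z y0.
    by field; rewrite gt_eqF.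
  rewrite sumrB; suff : \sum_(i <- s) g i x * ((h i).[x] - x / g i x) ^+ 2 <= k by lra.
  apply: le_trans dG; rewrite mulr_sumr big_seq [leRHS]big_seq.
  apply: ler_sum => i is_; rewrite mulrC ler_pM ?sqr_ge0//.
  - exact/ltW/g_gt0.
  - rewrite -real_normK ?num_real// ler_sqr ?nnegrE ?(ltW d0)//.
    by apply: hh => //; rewrite x0.
  - by rewrite /g lerD2r ler_wpM2l//; case: (s1 i is_).
have := @cfc_le _ _ B V BV pV _ _ (c `^ (r - 1) *: (Q + (2 * k)%:P)) hW.
rewrite op_polyZ// op_polyD// op_polyC// => /(_ _ xi).
rewrite [(_ *: (_ + _)) xi]/(_ *: (_ xi + _ *: _ xi)) rdotZl rdotDl rdotZl => W1.
apply: le_trans (W1 _) _.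
  by move=> t /sp tN; rewrite hornerZ hornerD hornerC; exact: Qlow.
rewrite ler_wpM2l ?powR_ge0// QE lerD2l.
apply: le_trans (ler_wpM2l _ (rdot_one_le B xi)) _; first by rewrite mulr_ge0 ?ltW.
have -> : e = 2 * k * (rnorm xi ^+ 2 + 1) by rewrite /k; field; rewrite gt_eqF.
by rewrite ler_wpM2l ?lerDl// mulr_ge0 ?ltW.
Qed.

(** * Integrals *)

Section Integral.
Context {R : realType} {T : ptopologicalType}.
Variable mu : {finite_measure set (borelType T) -> \bar R}.

Definition has_Rintegral (f : borelType T -> R) (v : R) :=
  mu.-integrable setT (EFin \o f) /\ v = \int[mu]_t f t.

Lemma has_RintegralD f g u v : has_Rintegral f u -> has_Rintegral g v ->
  has_Rintegral (fun t => f t + g t) (u + v).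
Proof.
move=> [fi ->] [gi ->]; split; last by rewrite RintegralD.
exact: (integrableD measurableT fi gi).
Qed.

Lemma has_RintegralZ (c : R) f u : has_Rintegral f u ->
  has_Rintegral (fun t => c * f t) (c * u).
Proof.
move=> [fi ->]; split; last by rewrite RintegralZl.
exact: (integrableZl measurableT c fi).
Qed.

Lemma has_RintegralB f g u v : has_Rintegral f u -> has_Rintegral g v ->
  has_Rintegral (fun t => f t - g t) (u - v).
Proof.
move=> hf /(has_RintegralZ (-1)) hg; have := has_RintegralD hf hg.
rewrite mulN1r; congr has_Rintegral.
by apply/funext => t; rewrite mulN1r.
Qed.

Lemma has_Rintegral_sum I (s : seq I) (F : I -> borelType T -> R) (v : I -> R) :
  (forall i, has_Rintegral (F i) (v i)) ->
  has_Rintegral (fun t => \sum_(i <- s) F i t) (\sum_(i <- s) v i).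
Proof.
move=> hF; elim: s => [|i s IH].
  rewrite big_nil; under eq_fun do rewrite big_nil.
  split; first exact: integrable0.
  by rewrite Rintegral_cst// mul0r.
rewrite big_cons; under eq_fun do rewrite big_cons.
exact: has_RintegralD.
Qed.

Lemma has_Rintegral_le (E : set (borelType T)) f g u v :
  measurable E -> mu E = 0%E -> has_Rintegral f u -> has_Rintegral g v ->
  (forall t, ~ E t -> f t <= g t) -> u <= v.
Proof.
move=> mE E0 hf hg fg; rewrite -subr_ge0.
have [hi ->] := has_RintegralB hg hf.
rewrite /Rintegral (negligible_integral mE measurableT hi E0).
apply: fine_ge0; apply: integral_ge0 => t [_ nEt].
by rewrite lee_fin subr_ge0 fg.
Qed.

Lemma has_Rintegral_ge0 f u : has_Rintegral f u -> (forall t, 0 <= f t) -> 0 <= u.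
Proof. by move=> [_ ->] f0; apply: Rintegral_ge0 => t _. Qed.

Lemma open_borel (O : set (borelType T)) : open (O : set T) -> measurable O.
Proof. by move=> oO; exact: sub_sigma_algebra. Qed.

Lemma continuous_borel (a : T -> R) : continuous a ->
  measurable_fun setT (a : borelType T -> R).
Proof.
move=> /continuousP ca; apply: (measurability _ (RGenOpens.measurableE R)).
by move=> _ [_ [x [y ->]] <-]; rewrite setTI; apply: open_borel; apply: ca; exact: interval_open.
Qed.

(** [epowR (a t) s] is infinite where [a] vanishes, and it is integrable. *)
Lemma epowR_null (a : T -> R) (s : R) : continuous a -> s < 0 ->
  (\int[mu]_t epowR (a t) s < +oo)%E ->
  measurable ([set t | a t = 0] : set (borelType T)) /\
  mu [set t | a t = 0] = 0%E.
Proof.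
move=> ca s0 ia; have ma := continuous_borel ca.
have mE : measurable ([set t | a t = 0] : set (borelType T)).
  have -> : [set t | a t = 0] = setT `&` a @^-1` [set 0] by rewrite setTI.
  exact: ma.
split => //.
have mp : measurable_fun setT (fun t : borelType T => epowR (a t) s).
  have -> : (fun t => epowR (a t) s) =
      (fun t => if a t == 0 then +oo%E else (a t `^ s)%:E).
    by apply/funext => t; rewrite /epowR s0 andbT.
  apply: measurable_fun_ifT.
  - apply: measurable_fun_eqr => //.
  - exact: measurable_cst.
  - apply/measurable_EFinP; exact: (measurableT_comp (measurable_powR s)).
have p0 t : (0 <= epowR (a t) s)%E.
  by rewrite /epowR; case: ifP => // _; rewrite lee_fin powR_ge0.
have := @ge0_subset_integral _ _ _ mu _ _ mE measurableT _ mp (fun t _ => p0 t) (@subsetT _ _).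
set E := [set t | a t = 0] in mE *.
have -> : (\int[mu]_(t in E) epowR (a t) s = \int[mu]_(t in E) cst +oo t)%E.
  by apply: eq_integral => t; rewrite inE /= => at0; rewrite /epowR at0 eqxx s0.
rewrite integral_cst// => /le_lt_trans/(_ ia).
have := measure_ge0 mu E; rewrite le_eqVlt => /orP[/eqP h _|h].
  by rewrite -h.
by rewrite (gt0_mulye h) ltxx.
Qed.

End Integral.

Section WeakIntegral.
Context {R : realType} {T : ptopologicalType} {K : hilbertType R}.
Variables (mu : {finite_measure set (borelType T) -> \bar R}) (B : cstarAlgebra K).

(** Vector functionals belong to the norm dual by the Cauchy-Schwarz inequality;
    through them the weak integral commutes with quadratic forms. *)
Lemma vector_functional (x y : K) : norm_dual B (fun Z => dot (Z x) y).
Proof.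
split; first by move=> c X Y _ _; rewrite dotDl dotZl.
exists (2 * (rnorm x * rnorm y)) => Z BZ.
have h1 : complex.Re `|dot (Z x) y| <= `|rdot (Z x) y| + `|complex.Im (dot (Z x) y)|.
  rewrite /rdot normc_def/=; case: (dot (Z x) y) => u v /=.
  have h0 : 0 <= `|u| + `|v| by rewrite addr_ge0.
  have E : Num.sqrt ((`|u| + `|v|) ^+ 2) = `|u| + `|v| by rewrite sqrtr_sqr ger0_norm.
  rewrite -E ler_wsqrtr// -(real_normK (num_real u)) -(real_normK (num_real v)).
  by rewrite sqrrD lerD2r lerDl mulrn_wge0// mulr_ge0.
apply: le_trans h1 _.
have h2 : `|rdot (Z x) y| <= rnorm (Z x) * rnorm y.
  rewrite ler_norml rdot_rnorm andbT lerNl -rdotNl -(rnormN (Z x)); exact: rdot_rnorm.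
apply: le_trans (lerD h2 (Im_dot_le _ _)) _.
have := ler_wpM2r (rnorm_ge0 y) (opnorm_bound (cstar_bounded BZ) x).
lra.
Qed.

Variable (F : borelType T -> K -> K).
Hypothesis F_int : bochner_integrable mu B F.
Let V := bochner_integral mu B F.

Lemma bochner_integralP : is_bochner_integral mu B F V.
Proof. by case: F_int => _ _ [W hW]; exact: (xgetPex 0 (ex_intro _ W hW)). Qed.

Lemma bochner_in : B V.
Proof. by case: bochner_integralP. Qed.

Lemma bochner_rdot x y : has_Rintegral mu (fun t => rdot (F t x) y) (rdot (V x) y).
Proof.
have [_ /(_ _ (vector_functional x y)) [[hi _] E]] := bochner_integralP.
split; first exact: hi.
by rewrite /rdot E.
Qed.

Lemma bochner_pos : (forall t, op_pos (F t)) -> op_pos V.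
Proof.
move=> pF; apply/op_posP => x; split; last first.
  by apply: has_Rintegral_ge0 (bochner_rdot x x) _ => t; exact: op_pos_rdot.
have [_ /(_ _ (vector_functional x x)) [_ ->]] /= := bochner_integralP.
rewrite (_ : (fun t => _) = cst 0) ?Rintegral_cst ?mul0r//.
by apply/funext => t; have /op_posP/(_ x)[] := pF t.
Qed.
End WeakIntegral.

Lemma op_powR_pos {R : realType} {H : hilbertType R} (A : cstarAlgebra H)
  (X : H -> H) (r : R) : A X -> op_pos X -> 1 < r -> r <= 2 ->
  op_pos (op_powR A X r).
Proof.
move=> AX pX r1 r2; have hY := op_powR_cfc AX pX r1 r2.
apply/op_posP => x; split; first exact: cfc_Im hY.
have := @cfc_ge _ _ A X AX pX _ _ 0 hY; rewrite -polyC0 op_polyC// scale0r.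
move=> /(_ _ x); rewrite [X in X <= _](_ : _ = 0); last exact: rdot0l.
by apply => t _; rewrite hornerC powR_ge0.
Qed.

(** The main inequality is proved with a constant [c > 0], so that one may divide
    by it; this covers the limit case where the constant vanishes. *)
Lemma powR_bound_limit {R : realType} (p c0 u z : R) : 0 < p -> 0 <= c0 -> 0 <= z ->
  (forall c, 0 < c -> c0 <= c -> u <= c `^ p * z) -> u <= c0 `^ p * z.
Proof.
move=> p0 c00 z0 hc.
move: c00; rewrite le_eqVlt => /orP[/eqP e0|c0p]; last exact: hc.
rewrite -e0 powR0 ?gt_eqF// mul0r; apply/ler_addgt0Pr => e e_gt0; rewrite add0r.
have z1 : 0 < z + 1 by rewrite ltr_wpDl.
have q0 : 0 < e / (z + 1) by rewrite divr_gt0.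
have := hc ((e / (z + 1)) `^ p^-1); rewrite -e0 powR_gt0// powR_ge0.
rewrite -powRrM mulVf ?gt_eqF// powRr1 ?(ltW q0)// => /(_ isT isT) h.
by apply: le_trans h _; rewrite mulrAC ler_pdivrMr// ler_wpM2l ?lerDl// ltW.
Qed.

(** * Jensen's inequality for a field of positive maps *)

Theorem theorem3p2 (R : realType) (T : ptopologicalType)
  (T_hausdorff : hausdorff_space T) (T_lc : locally_compact [set: T])
  (mu : {finite_measure set (borelType T) -> \bar R}) (mu_radon : radon mu)
  (H K : hilbertType R) (A : cstarAlgebra H) (B : cstarAlgebra K)
  (r : R) (r_gt1 : 1 < r) (r_le2 : r <= 2)
  (a : T -> R) (a_bounded : bounded_fun a) (a_continuous : continuous a)
  (a_ge0 : forall t, 0 <= a t)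
  (phi : T -> (H -> H) -> (K -> K))
  (phi_pos : forall t, positive_map A B (phi t))
  (a_int : (\int[mu]_t epowR (a t) (1 / (1 - r)) < +oo)%E)
  (phi_int : bochner_integrable mu B
     (fun t => (a t `^ (1 / (1 - r)))%:C%C *: phi t (cstar_one A)))
  (phi_le : op_le
     (bochner_integral mu B
        (fun t => (a t `^ (1 / (1 - r)))%:C%C *: phi t (cstar_one A)))
     ((fine (\int[mu]_t epowR (a t) (1 / (1 - r)))%E)%:C%C *: cstar_one B))
  (X : T -> (H -> H))
  (X_in : forall t, A (X t)) (X_pos : forall t, op_pos (X t))
  (X_continuous : continuous_field X)
  (phiX_int : bochner_integrable mu B (fun t => phi t (X t)))
  (phiXr_int : bochner_integrable mu B
     (fun t => (a t)%:C%C *: phi t (op_powR A (X t) r))) :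
  op_le
    (op_powR B (bochner_integral mu B (fun t => phi t (X t))) r)
    ((fine (\int[mu]_t epowR (a t) (1 / (1 - r)))%E `^ (r - 1))%:C%C *:
      bochner_integral mu B
        (fun t => (a t)%:C%C *: phi t (op_powR A (X t) r))).
Proof.
have s0 : 1 / (1 - r) < 0 by rewrite div1r invr_lt0 subr_lt0.
set s := 1 / (1 - r) in a_int phi_int phi_le s0 *.
set c0 := fine _ in phi_le *.
have c0_ge0 : 0 <= c0.
  apply/fine_ge0/integral_ge0 => t _.
  by rewrite /epowR; case: ifP => // _; rewrite lee_fin powR_ge0.
have [mE E0] := epowR_null a_continuous s0 a_int.
set V := bochner_integral mu B (fun t => phi t (X t)).
set M := bochner_integral mu B _ in phi_le.
set Z := bochner_integral mu B (fun t => (a t)%:C%C *: _).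
have BV : B V := bochner_in phiX_int.
have pV : op_pos V.
  by apply: (bochner_pos phiX_int) => t; apply: (positive_map_pos (phi_pos t)).
have pZ : op_pos Z.
  apply: (bochner_pos phiXr_int) => t x.
  have pY : op_pos (phi t (op_powR A (X t) r)).
    apply: (positive_map_pos (phi_pos t)); last exact: op_powR_pos.
    by case: (op_powR_cfc (X_in t) (X_pos t) r_gt1 r_le2).
  by rewrite dotZl mulr_ge0// lecR.
(* The forms are real, so that comparing their real parts is enough. *)
suff key x : rdot (op_powR B V r x) x <= c0 `^ (r - 1) * rdot (Z x) x.
  apply/op_posP => x.
  have E : (((c0 `^ (r - 1))%:C%C *: Z) - op_powR B V r) x =
     (c0 `^ (r - 1))%:C%C *: Z x - op_powR B V r x by [].
  rewrite E rdotBl rdotZl subr_ge0; split => //.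
  rewrite dotDl dotNl dotZl Im_add Im_opp Im_realM.
  have [-> _] := (op_posP _).1 pZ x.
  by rewrite (cfc_Im BV pV x (op_powR_cfc BV pV r_gt1 r_le2)) mulr0 subr0.
apply: powR_bound_limit => //; first by rewrite subr_gt0.
  exact: op_pos_rdot.
move=> c c_gt0 c0c; apply/ler_addgt0Pr => e e0.
have cp0 : 0 < c `^ (r - 1) by rewrite powR_gt0.
have [l [eta [hl]]] := powR_variational x r_gt1 r_le2 c_gt0 (divr_gt0 e0 cp0) BV pV.
move=> /le_trans; apply; rewrite mulrDr [_ * (e / _)]mulrC divfK ?gt_eqF// lerD2r.
rewrite ler_pM2l//.
(* [i.2 * c] multiplies the identity in the variational formula; as [c] bounds
   [M], the integral of [w phi(1)], it may be replaced by [M]. *)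
have hint : has_Rintegral mu
   (fun t => \sum_(i <- l) (2 * rdot (phi t (X t) x) (eta i)
     - (i.1 * rdot (phi t (X t) (eta i)) (eta i)
     + i.2 * rdot (((a t `^ s)%:C%C *: phi t (cstar_one A)) (eta i)) (eta i))))
   (\sum_(i <- l) (2 * rdot (V x) (eta i)
     - (i.1 * rdot (V (eta i)) (eta i) + i.2 * rdot (M (eta i)) (eta i)))).
  apply: has_Rintegral_sum => i; apply: has_RintegralB.
    exact/has_RintegralZ/(bochner_rdot phiX_int).
  apply: has_RintegralD; apply: has_RintegralZ.
    exact: (bochner_rdot phiX_int).
  exact: (bochner_rdot phi_int).
have hZ := bochner_rdot phiXr_int x x.
apply: (@le_trans _ _ (\sum_(i <- l) (2 * rdot (V x) (eta i)
     - (i.1 * rdot (V (eta i)) (eta i) + i.2 * rdot (M (eta i)) (eta i))))).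
  rewrite big_seq [leRHS]big_seq; apply: ler_sum => i /(proj1 hl)[_ i2].
  rewrite lerB// lerD2l ler_pM2l//.
  have := op_pos_rdot (eta i) phi_le.
  rewrite [(_ - M) _]/(c0%:C%C *: cstar_one B (eta i) - M (eta i)) rdotBl rdotZl subr_ge0.
  move=> /le_trans; apply; rewrite ler_wpM2r//; exact/op_pos_rdot/one_pos.
apply: (has_Rintegral_le mE E0 hint hZ) => t /eqP at0.
have at_gt0 : 0 < a t by rewrite lt_def at0 a_ge0.
have w0 : 0 < a t `^ s by rewrite powR_gt0.
(* With [w = a ^ s] one has [a = w ^ (1 - r)]. *)
have aw : (a t `^ s) `^ (1 - r) = a t.
  rewrite -powRrM /s div1r mulVf ?powRr1 ?ltW// lt_eqF// subr_lt0//.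
have := positive_map_powR (phi_pos t) x eta r_gt1 r_le2 hl w0 (X_in t) (X_pos t).
rewrite aw [rdot ((_ *: _) x) x]rdotZl.
by under [X in _ -> X <= _]eq_bigr do rewrite [rdot ((_ *: _) (eta _)) _]rdotZl.
Qed.
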